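(* For every integer $R\ge3$ there exist threshold numbers $m_R$ and $n_R$ and a constant $C_R>0$, depending only on $R$, such that for all integers $n,m$ with $1\le m\le n-1$, $m\ge m_R$, $n\ge n_R$ and $a_{n,2}>1$, $$\sup_{k\in\mathbb{Z}}|\mu\{k\}-\nu_R\{k\}|\le C_R\left(\frac1{\sqrt m}\right)^R\quad\text{if } m\le\frac n2-1,$$ and $$\sup_{k\in\mathbb{Z}}|\mu\{k\}-\nu_R\{k\}|\le C_R\frac{(\sqrt n)^{R-2}}{(n-m)^{R-1}}\quad\text{if } m\ge\frac n2.$$
   Context: Coupon collector's waiting time: coupons are drawn independently and uniformly at random with replacement from $n$ distinct coupons, and $W_{n,m}$ is the number of draws until $n-m$ distinct coupons have been collected for the first time. Let $\widetilde W_{n,m}=W_{n,m}-(n-m)$; equivalently it is distributed as $\sum_{k=m+1}^n\widetilde X_k$ with independent $\widetilde X_k$ satisfying $\mathbf P(\widetilde X_k=j)=(1-\frac kn)^j\frac kn$, $j=0,1,\ldots$. Let $\sigma_n^2=\mathbf{Var}(W_{n,m})=n\sum_{k=m+1}^n\frac{n-k}{k^2}$ and, for $j\ge1$, $a_{n,j}=\sum_{k=m+1}^n\left(\frac{n-k}k\right)^j$. Let $\mu$ be the distribution of $\widetilde W_{n,m}+c$, where $c=\lfloor a_{n,2}\rfloor$ ($=\lfloor\mathbf{Var}\widetilde W_{n,m}-\mathbf E\widetilde W_{n,m}\rfloor$). For an integer $R\ge3$ define polynomials $$h_R(w)=-(a_{n,2}-\lfloor a_{n,2}\rfloor)w+(a_{n,2}-\lfloor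 a_{n,2}\rfloor)\frac{w^2}2+\sum_{r=3}^R\big(a_{n,r}+(-1)^{r+1}\lfloor a_{n,2}\rfloor\big)\frac{w^r}r,\qquad H_R(w)=\sum_{l=0}^R\frac{h_R(w)^l}{l!}.$$ $\nu_R$ is the finite signed measure on the nonnegative integers (a Poisson–Charlier signed measure) whose characteristic function is $$\sum_{j\ge0}e^{itj}\nu_R\{j\}=\exp\{\sigma_n^2(e^{it}-1)\}\,H_R(e^{it}-1),\qquad t\in\mathbb{R}.$$ *)

(* Defs.v *)
From HB Require Import structures.
From mathcomp Require Import all_boot all_order all_algebra.
From mathcomp Require Import all_classical all_reals all_analysis.
From mathcomp Require Import complex.

Set Implicit Arguments.
Unset Strict Implicit.
Unset Printing Implicit Defensive.

Import Order.TTheory GRing.Theory Num.Theory.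
Import numFieldNormedType.Exports.

Local Open Scope classical_set_scope.
Local Open Scope ring_scope.
Local Open Scope complex_scope.

Section CouponCollector.
Variables (K : realType) (d : measure_display) (T : measurableType d).
Variables (P : probability T K) (n : nat).

(* [D i w] is the coupon obtained at draw [i] (draws are numbered from 0).
   Subsets of ['I_n] are all measurable, and independence is that of the whole
   infinite family: the product rule for every finite subfamily. *)
Definition coupon_draws (D : nat -> T -> 'I_n) : Prop :=
  [/\ forall i (A : set 'I_n), measurable (D i @^-1` A),
      forall i (c : 'I_n), P (D i @^-1` [set c]) = (n%:R^-1)%:E
    & forall (s : seq nat) (A : nat -> set 'I_n), uniq s ->
        P (\bigcap_(i in [set` s]) (D i @^-1` A i)) =
        (\prod_(i <- s) P (D i @^-1` A i))%E].

Definition distinct_coupons (D : nat -> T -> 'I_n) (t : nat) (w : T) : nat :=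
  size (undup [seq D i w | i <- iota 0 t]).

(* The value is [+oo] on the outcomes where [n - m] distinct coupons are never
   collected. *)
Definition waiting_time (D : nat -> T -> 'I_n) (m : nat) (w : T) : \bar K :=
  ereal_inf [set (t%:R)%:E | t in
    [set t : nat | (n - m <= distinct_coupons D t w)%N]].

End CouponCollector.

Arguments waiting_time K {d T n} D m w.

Section Expansion.
Variables (K : realType) (n m : nat).

Definition coupon_a (j : nat) : K :=
  \sum_(m.+1 <= k < n.+1) ((n%:R - k%:R) / k%:R) ^+ j.

Definition coupon_sigma2 : K :=
  n%:R * \sum_(m.+1 <= k < n.+1) (n%:R - k%:R) / k%:R ^+ 2.

Definition coupon_c : int := Num.floor (coupon_a 2).

Definition coupon_h (r : nat) : {poly K} :=
  - (coupon_a 2 - coupon_c%:~R) *: 'X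
  + ((coupon_a 2 - coupon_c%:~R) / 2) *: 'X^2
  + \sum_(3 <= i < r.+1)
      ((coupon_a i + (-1) ^+ i.+1 * coupon_c%:~R) / i%:R) *: 'X^i.

Definition coupon_H (r : nat) : {poly K} :=
  \sum_(0 <= l < r.+1) (l`!%:R)^-1 *: coupon_h r ^+ l.

End Expansion.

Definition shifted_waiting_time (K : realType) (d : measure_display)
    (T : measurableType d) (n : nat) (D : nat -> T -> 'I_n) (m : nat) (w : T)
    : \bar K :=
  (waiting_time K D m w - ((n - m)%:R)%:E + ((coupon_c K n m)%:~R)%:E)%E.

Arguments shifted_waiting_time K {d T n} D m w.

Definition coupon_mu (K : realType) (d : measure_display)
    (T : measurableType d) (P : probability T K) (n : nat)
    (D : nat -> T -> 'I_n) (m : nat) (k : int) : \bar K :=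
  P (shifted_waiting_time K D m @^-1` [set (k%:~R)%:E]).

Definition cexp (K : realType) (z : K[i]) : K[i] :=
  (expR (complex.Re z))%:C * (cos (complex.Im z) +i* sin (complex.Im z)).

(* [nu], a finite signed measure on [nat], is determined by its characteristic
   function; the series is a limit of partial sums in [K[i]]. *)
Definition poisson_charlier (K : realType) (n m r : nat)
    (nu : {charge set nat -> \bar K}) : Prop :=
  forall t : K,
    (\sum_(0 <= j < N) cexp (0 +i* (t * j%:R)) * (fine (nu [set j]))%:C)
      @[N --> \oo] -->
    (cexp ((coupon_sigma2 K n m)%:C * (cexp (0 +i* t) - 1))
     * (map_poly (real_complex K) (coupon_H K n m r)).[cexp (0 +i* t) - 1]
       : K[i]^o).

(* Mass that a signed measure on [nat], viewed as one on [int], gives to [k]. *)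
Definition int_mass (K : realType) (nu : {charge set nat -> \bar K})
    (k : int) : \bar K :=
  if k is Posz j then nu [set j] else 0%E.

(* Main.v *)
(* Write q_k = (n - k) / k and w = exp (i t) - 1. The characteristic function of
   mu is (1 + w)^c * prod_k 1 / (1 - q_k w), because the sequence of numbers of
   distinct coupons turns the waiting time into a sum of geometric variables. Its
   logarithm, truncated at order r, is sigma^2 w + h_r (w), so that for small |w|
   it differs from exp (sigma^2 w) H_r (w) by the Taylor remainders of the
   logarithm and of the exponential, multiplied by exp (- sigma^2 |w|^2 / 2); for
   large |w| both characteristic functions are Gaussian small.

   In both regimes the remainder is governed by two parameters 1 <= B <= rho^2 with
   (1 + max q_k) rho <= 4 sigma and a_2 rho^2 <= B sigma^2: the pointwise error is
   O(B rho^-(r+1) / (1 + sigma^2 |w|^2) + B rho^-(r+2)), hence sup_k |mu{k} - nu{k}|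
   is O(B rho^-(r+2)). The choices rho = sqrt m, B = m and rho = sigma, B = a_2 give
   the two bounds.

   Fourier inversion is done with averages over the N-th roots of unity, N going
   to infinity, instead of integrals over the circle. *)

Require Import Defs.
From HB Require Import structures.
From mathcomp Require Import all_boot all_order all_algebra.
From mathcomp Require Import all_classical all_reals all_analysis.
From mathcomp Require Import complex.
From mathcomp Require Import ring lra zify.

Set Implicit Arguments.
Unset Strict Implicit.
Unset Printing Implicit Defensive.

Import Order.TTheory GRing.Theory Num.Theory.
Import numFieldNormedType.Exports.

Local Open Scope classical_set_scope.
Local Open Scope ring_scope.

Local Open Scope complex_scope.

Local Notation normc := Normc.normc.

(** * Modulus, exponential and derivatives along a real line in [K[i]] *)

Section ComplexNorm.
Variable K : realType.
Implicit Types (z u : K[i]).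

(** No complex logarithm is used. Each factor [1 - u] times the exponential of the truncated series
    of [- ln (1 - u)] equals [1 + e] exactly, with [e] small. The errors of all factors are gathered
    as bounds [normc (z - 1) <= expR a - 1], which pass to products by adding the [a].

    The last power of [rho] comes from averaging: the kernel [1 / (1 + sigma^2 |w|^2)] has mean O(1
    / sigma) over the circle, and [rho <= 4 sigma]. The Gaussian factor is weakened to this kernel
    because its sums have a telescoping majorant.

    [B] is kept apart from [rho^2] for the sake of the regime [m >= n / 2]: there [a_2 / sigma^2] is
    at most [16 (n - m) / n], and this gain is part of the claimed bound.

    Roots of unity keep the inversion within finite sums. The price is aliasing, bounded by the tail
    of the absolutely summable sequence [mu - nu] beyond [N]. *)

Lemma normrC z : `|z| = (normc z)%:C.
Proof. by case: z. Qed.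

Lemma normc_ge0 z : 0 <= normc z.
Proof. by case: z => a b /=; exact: sqrtr_ge0. Qed.

Lemma normcX z n : normc (z ^+ n) = normc z ^+ n.
Proof.
by elim: n => [|n IH]; rewrite ?expr0 ?Normc.normc1// !exprS Normc.normcM IH.
Qed.

Lemma normcD_le z u : normc (z + u) <= normc z + normc u.
Proof. exact: (@le_normcD K z u). Qed.

Lemma normcN_eq z : normc (- z) = normc z.
Proof. exact: (@normcN K z). Qed.

Lemma normcB_le z u : normc (z - u) <= normc z + normc u.
Proof. by rewrite -(normcN_eq u) normcD_le. Qed.

Lemma normc_sum_le (I : Type) (s : seq I) (Q : pred I) (F : I -> K[i]) :
  normc (\sum_(i <- s | Q i) F i) <= \sum_(i <- s | Q i) normc (F i).
Proof.
apply: (big_ind2 (fun a b => normc a <= b)) => //.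
  by rewrite Normc.normc0.
by move=> a b a' b' h h'; rewrite (le_trans (normcD_le _ _))// lerD.
Qed.

Lemma normc_prod (I : Type) (s : seq I) (Q : pred I) (F : I -> K[i]) :
  normc (\prod_(i <- s | Q i) F i) = \prod_(i <- s | Q i) normc (F i).
Proof.
by apply: (big_morph (@Normc.normc K)) => [a b|]; rewrite ?Normc.normcM ?Normc.normc1.
Qed.

Lemma normc_real (a : K) : normc a%:C = `|a|.
Proof. by rewrite /= expr0n/= addr0 sqrtr_sqr. Qed.

Lemma normc_le_ReIm z : normc z <= `|complex.Re z| + `|complex.Im z|.
Proof.
rewrite {1}(complexE z).
rewrite (le_trans (normcD_le _ _))// Normc.normcM !normc_real.
by rewrite /= expr0n/= add0r expr1n sqrtr1 mul1r.
Qed.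

Lemma normRe_le z : `|complex.Re z| <= normc z.
Proof. by have := normc_ge_Re z; rewrite normrC lecR. Qed.

Lemma sqr_normcE z : normc z ^+ 2 = complex.Re z ^+ 2 + complex.Im z ^+ 2.
Proof. by case: z => a b /=; rewrite sqr_sqrtr // addr_ge0 ?sqr_ge0. Qed.

Lemma normIm_le z : `|complex.Im z| <= normc z.
Proof.
rewrite -(@ler_pXn2r _ 2)// ?nnegrE ?normr_ge0 ?normc_ge0//.
by rewrite sqr_normcE real_normK ?num_real// lerDr sqr_ge0.
Qed.

Lemma normc_eq0 z : (normc z == 0) = (z == 0).
Proof.
by apply/eqP/eqP => [/Normc.eq0_normc//|->]; rewrite Normc.normc0.
Qed.

Lemma normc_gt0 z : (0 < normc z) = (z != 0).
Proof. by rewrite lt_neqAle normc_ge0 andbT eq_sym normc_eq0. Qed.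

End ComplexNorm.

Ltac nonneg := repeat first
  [ done | exact: normc_ge0 | exact: expR_ge0 | exact: normr_ge0
  | exact: ler0n | exact: sqrtr_ge0 | by apply: ltW
  | apply: exprn_ge0 | apply: divr_ge0 | apply: mulr_ge0 | apply: addr_ge0
  | rewrite invr_ge0 | apply: sumr_ge0 => ? _ ].

Section ComplexExp.
Variable K : realType.
Implicit Types (z u : K[i]).

Lemma cexpD z u : cexp (z + u) = cexp z * cexp u.
Proof.
case: z u => [a b] [a' b']; rewrite /cexp /= expRD cosD sinD.
by rewrite mulrACA -rmorphM/=; congr (_ * _); simpc; congr (_ +i* _); ring.
Qed.

Lemma cexp0 : cexp 0 = 1 :> K[i].
Proof. by rewrite /cexp /= expR0 cos0 sin0 mul1r. Qed.

Lemma normc_cexp z : normc (cexp z) = expR (complex.Re z).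
Proof.
rewrite /cexp Normc.normcM normc_real ger0_norm ?expR_ge0//.
by rewrite /= cos2Dsin2 sqrtr1 mulr1.
Qed.

Lemma normc_cexp_le z : normc (cexp z) <= expR (normc z).
Proof.
by rewrite normc_cexp ler_expR (le_trans (ler_norm _))// normRe_le.
Qed.

Lemma cexpMn z n : cexp (z *+ n) = cexp z ^+ n.
Proof. by elim: n => [|n IH]; rewrite ?mulr0n ?cexp0// mulrS cexpD IH exprS. Qed.

Lemma cexpN z : cexp (- z) * cexp z = 1.
Proof. by rewrite -cexpD addNr cexp0. Qed.

Lemma normc_cis (t : K) : normc (cexp (0 +i* t)) = 1.
Proof. by rewrite normc_cexp expR0. Qed.

End ComplexExp.

Section ComplexDerive.
Variable K : realType.

(** Stated by components, so that each one can be fed to the real mean value theorem. *)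
Definition is_cderive (f : K -> K[i]) (s : K) (l : K[i]) : Prop :=
  is_derive s 1 (fun x => complex.Re (f x)) (complex.Re l) /\
  is_derive s 1 (fun x => complex.Im (f x)) (complex.Im l).

Lemma is_cderive_cst (c : K[i]) s : is_cderive (fun=> c) s 0.
Proof. by split; exact: is_derive_cst. Qed.

Lemma is_cderive_eq f s l l' : is_cderive f s l -> l = l' -> is_cderive f s l'.
Proof. by move=> ? <-. Qed.

Lemma is_cderive_id s : is_cderive (real_complex K) s 1.
Proof.
split; rewrite /=; first exact: is_derive_id.
exact: is_derive_cst.
Qed.

Lemma is_cderiveD f g s l l' : is_cderive f s l -> is_cderive g s l' ->
  is_cderive (fun x => f x + g x) s (l + l').
Proof.
move=> [a b] [c d]; split; rewrite raddfD/=.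
  rewrite (_ : (fun x => _) = (fun x => complex.Re (f x)) \+ (fun x => complex.Re (g x))).
    exact: is_deriveD.
  by apply/funext => x/=; rewrite raddfD.
rewrite (_ : (fun x => _) = (fun x => complex.Im (f x)) \+ (fun x => complex.Im (g x))).
  exact: is_deriveD.
by apply/funext => x/=; rewrite raddfD.
Qed.

Lemma ReD (z u : K[i]) : complex.Re (z + u) = complex.Re z + complex.Re u.
Proof. exact: raddfD. Qed.

Lemma ImD (z u : K[i]) : complex.Im (z + u) = complex.Im z + complex.Im u.
Proof. exact: raddfD. Qed.

Lemma ReM (z u : K[i]) : complex.Re (z * u) =
  complex.Re z * complex.Re u - complex.Im z * complex.Im u.
Proof. by case: z u => a b [c d]. Qed.

Lemma ImM (z u : K[i]) : complex.Im (z * u) =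
  complex.Re z * complex.Im u + complex.Im z * complex.Re u.
Proof. by case: z u => a b [c d]. Qed.

Lemma is_cderiveM f g s l l' : is_cderive f s l -> is_cderive g s l' ->
  is_cderive (fun x => f x * g x) s (l * g s + f s * l').
Proof.
move=> [a b] [c d]; split.
  rewrite (_ : (fun x => _) =
    (fun x => complex.Re (f x)) * (fun x => complex.Re (g x))
    - (fun x => complex.Im (f x)) * (fun x => complex.Im (g x))); last first.
    by apply/funext => x; rewrite ReM.
  apply: is_derive_eq; rewrite [RHS]ReD (ReM l) (ReM (f s)) /GRing.scale/=; ring.
rewrite (_ : (fun x => _) =
    (fun x => complex.Re (f x)) * (fun x => complex.Im (g x))
    + (fun x => complex.Im (f x)) * (fun x => complex.Re (g x))); last first.
    by apply/funext => x; rewrite ImM.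
apply: (is_derive_eq (is_deriveD (is_deriveM a d) (is_deriveM b c))).
rewrite [RHS]ImD (ImM l) (ImM (f s)) /GRing.scale/=.
ring.
Qed.

Lemma is_cderive_cexp f s l : is_cderive f s l ->
  is_cderive (fun x => cexp (f x)) s (l * cexp (f s)).
Proof.
move=> [a b].
pose F x := complex.Re (f x). pose G x := complex.Im (f x).
have eF : is_derive s 1 (expR \o F) (expR (F s) * complex.Re l).
  exact: is_derive1_comp.
have cG : is_derive s 1 (cos \o G) (- sin (G s) * complex.Im l).
  exact: is_derive1_comp.
have sG : is_derive s 1 (sin \o G) (cos (G s) * complex.Im l).
  exact: is_derive1_comp.
split.
  rewrite (_ : (fun x => _) = (expR \o F) * (cos \o G)); last first.
    by apply/funext => x; rewrite /cexp ReM/= mul0r subr0.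
  apply: is_derive_eq; rewrite /cexp !ReM !ImM/= /GRing.scale/= -/(F s) -/(G s); ring.
rewrite (_ : (fun x => _) = (expR \o F) * (sin \o G)); last first.
  by apply/funext => x; rewrite /cexp ImM/= mul0r addr0.
apply: is_derive_eq; rewrite /cexp !ImM !ReM/= /GRing.scale/= -/(F s) -/(G s); ring.
Qed.

Lemma is_cderive_ray u s : is_cderive (fun x => x%:C * u) s u.
Proof.
apply: is_cderive_eq (is_cderiveM (is_cderive_id s) (is_cderive_cst u s)) _.
by rewrite mul1r mulr0 addr0.
Qed.

Lemma is_cderiveX f s l n : is_cderive f s l ->
  is_cderive (fun x => f x ^+ n.+1) s (n.+1%:R * l * f s ^+ n).
Proof.
move=> df; elim: n => [|n IH].
  by rewrite expr0 mulr1 mul1r; under [fun x => _]eq_fun do rewrite expr1.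
under [fun x => _]eq_fun do rewrite exprS.
apply: is_cderive_eq (is_cderiveM df IH) _.
by rewrite [in RHS]mulrSr exprS; ring.
Qed.

Lemma is_cderive_sum (I : Type) (r : seq I) (F : I -> K -> K[i]) s (l : I -> K[i]) :
  (forall i, is_cderive (F i) s (l i)) ->
  is_cderive (fun x => \sum_(i <- r) F i x) s (\sum_(i <- r) l i).
Proof.
move=> dF; elim: r => [|i r IH].
  by rewrite big_nil; under [fun x => _]eq_fun do rewrite big_nil;
    exact: is_cderive_cst.
rewrite big_cons; under [fun x => _]eq_fun do rewrite big_cons.
exact: is_cderiveD.
Qed.

(** The mean value theorem gives different intermediate points for the real and the imaginary part;
    adding the two bounds produces the factor 2. *)
Lemma normc_mvt (f df : K -> K[i]) (M : K) :
  (forall s, is_cderive f s (df s)) ->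
  (forall s, 0 <= s <= 1 -> normc (df s) <= M) ->
  normc (f 1 - f 0) <= 2 * M.
Proof.
move=> dfE dfM.
have cont (g dg : K -> K) : (forall s : K, is_derive s 1 g (dg s)) ->
    {within `[0, 1], continuous g}.
  move=> dg1; apply: derivable_within_continuous => x _.
  by case: (dg1 x).
have [x x01 fx] := MVT_segment ler01 (fun s _ => (dfE s).1)
  (cont _ _ (fun s => (dfE s).1)).
have [y y01 fy] := MVT_segment ler01 (fun s _ => (dfE s).2)
  (cont _ _ (fun s => (dfE s).2)).
rewrite (le_trans (normc_le_ReIm _))// !raddfB/= fx fy subr0 !mulr1.
move: x01 y01; rewrite !in_itv/= => x01 y01.
rewrite mulr_natl mulr2n lerD//.
  by rewrite (le_trans (normRe_le _)) ?dfM.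
by rewrite (le_trans (normIm_le _)) ?dfM.
Qed.

End ComplexDerive.

(** * Taylor remainders of the exponential and the logarithm; products of factors close to 1 *)

Section TaylorBounds.
Variable K : realType.
Implicit Types (z u : K[i]).

(** Along the ray [s * z] the remainder of order [M.+1] has derivative [z] times the remainder of
    order [M]. Each induction step pays the factor 2 of [normc_mvt], whence [2 ^+ M]. *)
Lemma cexp_taylor z M :
  normc (cexp z - \sum_(0 <= l < M) (l`!%:R)^-1 * z ^+ l)
  <= 2 ^+ M * normc z ^+ M * expR (normc z).
Proof.
elim: M z => [|M IH] z.
  by rewrite big_nil subr0 !expr0 !mul1r normc_cexp_le.
pose f (s : K) := cexp (s%:C * z) +
  - 1 * (1 + \sum_(0 <= l < M) (l.+1`!%:R)^-1 * (s%:C * z) ^+ l.+1).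
pose df (s : K) := z * (cexp (s%:C * z) -
  \sum_(0 <= l < M) (l`!%:R)^-1 * (s%:C * z) ^+ l).
have fE s : f s = cexp (s%:C * z) -
    \sum_(0 <= l < M.+1) (l`!%:R)^-1 * (s%:C * z) ^+ l.
  by rewrite /f big_nat_recl// fact0 expr0 invr1 mulr1 mulN1r.
have f0 : f 0 = 0.
  rewrite /f mul0r cexp0 big1 ?addr0 ?mulN1r ?subrr// => l _.
  by rewrite expr0n mulr0.
rewrite -[z]mul1r -(rmorph1 (real_complex K)) -fE rmorph1 mul1r.
rewrite -[f 1]subr0 -f0.
have -> : 2 ^+ M.+1 * normc z ^+ M.+1 * expR (normc z) =
    2 * (normc z * (2 ^+ M * normc z ^+ M * expR (normc z))).
  by rewrite !exprS; ring.
apply: (@normc_mvt K f df) => s; last first.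
  move=> /andP[s0 s1]; rewrite /df Normc.normcM ler_wpM2l ?normc_ge0//.
  rewrite (le_trans (IH _))// Normc.normcM normc_real ger0_norm//.
  have sz : s * normc z <= normc z by rewrite ler_piMl ?normc_ge0.
  apply: ler_pM; rewrite ?ler_expR//; nonneg.
  by rewrite ler_wpM2l ?exprn_ge0// lerXn2r ?nnegrE//; nonneg.
apply: is_cderive_eq.
  apply: is_cderiveD; first exact/is_cderive_cexp/is_cderive_ray.
  apply: is_cderiveM; first exact: is_cderive_cst.
  apply: is_cderiveD; first exact: is_cderive_cst.
  apply: is_cderive_sum => l; apply: is_cderiveM; first exact: is_cderive_cst.
  exact/is_cderiveX/is_cderive_ray.
rewrite /df mul0r !add0r mulN1r mulrBr; congr (_ - _).
rewrite big_distrr/=; apply: eq_bigr => l _.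
rewrite mul0r add0r factS natrM invfM.
have : (l.+1%:R : K[i]) != 0 by rewrite pnatr_eq0.
by move: (l`!%:R^-1) (_ ^+ l) (l.+1%:R) => a b c c0; field.
Qed.

(* Truncated Taylor series of [- ln (1 - u)]. *)
Definition clog_poly (M : nat) (u : K[i]) : K[i] :=
  \sum_(0 <= l < M) (l.+1%:R)^-1 * u ^+ l.+1.

Lemma normc_natV (l : nat) : normc ((l%:R : K[i])^-1) = l%:R^-1.
Proof.
have -> : (l%:R : K[i]) = (l%:R : K)%:C by rewrite rmorph_nat.
by rewrite Normc.normcV normc_real ger0_norm.
Qed.

Lemma expR1_le4 : expR 1 <= 4 :> K.
Proof.
have := expR_ge1Dx (- 2^-1 : K); rewrite expRN => h.
have e0 : 0 < expR (2^-1 : K) by exact: expR_gt0.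
have e2 : expR (2^-1 : K) <= 2.
  by rewrite -[leRHS]invrK -[leLHS]invrK lef_pV2 ?posrE ?invr_gt0//; lra.
have -> : (1 : K) = 2^-1 + 2^-1 by lra.
by rewrite expRD; nra.
Qed.

Lemma sum_geom_le2 (a : K) M : 0 <= a <= 2^-1 ->
  \sum_(0 <= l < M) a ^+ l <= 2.
Proof.
move=> /andP[a0 a2]; rewrite big_mkord.
have a1 : 0 < 1 - a by rewrite subr_gt0 (le_lt_trans a2)// invf_lt1 ?ltr1n.
have : (1 - a) * \sum_(i < M) a ^+ i <= 1.
  rewrite -opprB mulNr -subrX1 opprB lerBlDr lerDl exprn_ge0//.
rewrite mulrC -ler_pdivlMr// => /le_trans; apply.
rewrite div1r -[leRHS]invrK lef_pV2 ?posrE ?invr_gt0//; lra.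
Qed.

Lemma normc_clog_poly M u : normc u <= 2^-1 ->
  normc (clog_poly M u) <= 2 * normc u.
Proof.
move=> u2; rewrite (le_trans (normc_sum_le _ _ _))//.
apply: (@le_trans _ _ (\sum_(0 <= l < M) normc u ^+ l * normc u)).
  apply: ler_sum => l _; rewrite Normc.normcM normc_natV normcX exprSr.
  rewrite ler_piMl ?mulr_ge0 ?exprn_ge0 ?normc_ge0//.
  by rewrite invf_le1 ?ler1n.
rewrite -mulr_suml ler_wpM2r ?normc_ge0// sum_geom_le2//.
by rewrite normc_ge0.
Qed.

Lemma clog_poly_ray M u (s : K) :
  is_cderive (fun x => clog_poly M (x%:C * u)) s
    (u * \sum_(0 <= l < M) (s%:C * u) ^+ l).
Proof.
apply: is_cderive_eq.
  apply: is_cderive_sum => l; apply: is_cderiveM; first exact: is_cderive_cst.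
  exact/is_cderiveX/is_cderive_ray.
rewrite big_distrr/=; apply: eq_bigr => l _.
by rewrite mul0r add0r -mulrA mulKf// pnatr_eq0.
Qed.

(* The derivative of [(1 - s u) * cexp (clog_poly M (s u))] in [s] is
   [- u * (s u) ^ M * cexp (clog_poly M (s u))]: the sum telescopes. *)
Lemma clog_taylor M u : normc u <= 2^-1 ->
  normc ((1 - u) * cexp (clog_poly M u) - 1) <= 8 * normc u ^+ M.+1.
Proof.
move=> u2.
pose f (s : K) := (1 + - 1 * (s%:C * u)) * cexp (clog_poly M (s%:C * u)).
pose df (s : K) := - u * (s%:C * u) ^+ M * cexp (clog_poly M (s%:C * u)).
have f1 : f 1 = (1 - u) * cexp (clog_poly M u).
  by rewrite /f rmorph1 mul1r mulN1r.
have f0 : f 0 = 1.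
  rewrite /f mul0r mulr0 addr0 mul1r /clog_poly big1 ?cexp0// => l _.
  by rewrite expr0n mulr0.
rewrite -f1 -f0.
have -> : 8 * normc u ^+ M.+1 = 2 * (4 * normc u ^+ M.+1) by ring.
apply: (@normc_mvt K f df) => s; last first.
  move=> /andP[s0 s1]; rewrite /df 2!Normc.normcM normcN_eq normcX.
  rewrite (Normc.normcM s%:C) normc_real ger0_norm//.
  have su : s * normc u <= normc u by rewrite ler_piMl ?normc_ge0.
  rewrite exprS mulrC ler_pM//; [nonneg|nonneg| |].
    rewrite (le_trans (normc_cexp_le _))//.
    rewrite (@le_trans _ _ (expR 1))//; last exact: expR1_le4.
    rewrite ler_expR (le_trans (normc_clog_poly _ _))//.
      by rewrite Normc.normcM normc_real ger0_norm// (le_trans su).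
    rewrite Normc.normcM normc_real ger0_norm//; lra.
  by rewrite ler_wpM2l ?normc_ge0 ?lerXn2r ?nnegrE ?mulr_ge0 ?normc_ge0.
apply: is_cderive_eq.
  apply: is_cderiveM; last exact/is_cderive_cexp/clog_poly_ray.
  apply: is_cderiveD; first exact: is_cderive_cst.
  apply: is_cderiveM; [exact: is_cderive_cst|exact: is_cderive_ray].
rewrite /df; set x := s%:C * u; set E := cexp _.
have := subrX1 x M; rewrite -(big_mkord xpredT (fun i => x ^+ i)) => gE.
have -> : x ^+ M = 1 + (x - 1) * \sum_(0 <= i < M) x ^+ i by rewrite -gE; ring.
by ring.
Qed.

(** The first identity serves the geometric factors; the second, at [u = - w], serves the shift
    [(1 + w) ^+ c]. Inverting [1 + e], whose modulus is at least [2^-1], turns the constant 8 of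
    [clog_taylor] into 16. *)
Lemma clog_factor M u : (2 <= M)%N -> normc u <= 4^-1 ->
  (exists2 e, (1 - u)^-1 = cexp (clog_poly M u) * (1 + e) &
              normc e <= 16 * normc u ^+ M.+1) /\
  (exists2 e, 1 - u = cexp (- clog_poly M u) * (1 + e) &
              normc e <= 16 * normc u ^+ M.+1).
Proof.
move=> M2 u4; have u2 : normc u <= 2^-1 by lra.
have := clog_taylor M u2.
set L := clog_poly M u; set e := _ - 1 => eM.
have eE : (1 - u) * cexp L = 1 + e by rewrite /e addrCA subrr addr0.
have pu : 0 <= normc u ^+ M.+1 by rewrite exprn_ge0 ?normc_ge0.
split; last first.
  exists e; last by apply: (le_trans eM); lra.
  by rewrite -eE mulrCA cexpN mulr1.
have e2 : normc e <= 2^-1.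
  apply: (le_trans eM).
  have : normc u ^+ M.+1 <= 4^-1 ^+ 3.
    apply: (@le_trans _ _ (4^-1 ^+ M.+1)).
      by rewrite lerXn2r ?nnegrE ?normc_ge0// invr_ge0.
    by rewrite ler_wiXn2l ?invr_ge0 ?invf_le1 ?ler1n.
  lra.
have n1e : normc (1 + e) >= 2^-1.
  have := normcB_le (1 + e) e; rewrite addrK Normc.normc1; lra.
have e0 : 1 + e != 0 by rewrite -normc_eq0 gt_eqF//; lra.
have u0 : 1 - u != 0 by apply: contraNneq e0; rewrite -eE => ->; rewrite mul0r.
exists (- (e / (1 + e))).
  apply: (mulfI u0); rewrite mulfV// mulrA eE mulrDr mulr1 mulrN mulrCA mulfV//.
  by rewrite mulr1 addrK.
rewrite normcN_eq Normc.normcM Normc.normcV ler_pdivrMr; last by lra.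
apply: (le_trans eM).
have -> : 8 * normc u ^+ M.+1 = 16 * normc u ^+ M.+1 * 2^-1 by lra.
by apply: ler_wpM2l => //; rewrite mulr_ge0.
Qed.

(** Expand [z * u - 1] in [z - 1] and [u - 1]: with bounds of the form [expR a - 1] the three terms
    add up to exactly [expR (a + b) - 1]. *)
Lemma normc1DM z u (a b : K) : 0 <= a -> 0 <= b ->
  normc (z - 1) <= expR a - 1 -> normc (u - 1) <= expR b - 1 ->
  normc (z * u - 1) <= expR (a + b) - 1.
Proof.
move=> a0 b0 za ub.
have -> : z * u - 1 = (z - 1) * (u - 1) + (z - 1) + (u - 1) by ring.
rewrite (le_trans (normcD_le _ _))// (le_trans (lerD (normcD_le _ _) ub))//.
rewrite Normc.normcM expRD.
have : normc (z - 1) * normc (u - 1) <= (expR a - 1) * (expR b - 1).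
  by rewrite ler_pM ?normc_ge0.
by nra.
Qed.

Lemma normc1D_expR (e : K[i]) : normc ((1 + e) - 1) <= expR (normc e) - 1.
Proof. by have := expR_ge1Dx (normc e); rewrite [1 + e]addrC addrK; lra. Qed.

Lemma normc_prod1D (I : Type) (r : seq I) (F : I -> K[i]) (a : I -> K) :
  (forall i, 0 <= a i) ->
  (forall i, normc (F i - 1) <= expR (a i) - 1) ->
  normc (\prod_(i <- r) F i - 1) <= expR (\sum_(i <- r) a i) - 1.
Proof.
move=> a0 Fa; elim: r => [|i r IH].
  by rewrite !big_nil subrr Normc.normc0 expR0 subrr.
by rewrite !big_cons normc1DM// sumr_ge0.
Qed.

Lemma expR_sub1_le (a : K) : expR a - 1 <= a * expR a.
Proof.
have := expR_ge1Dx (- a); rewrite expRN => h.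
have e0 := expR_gt0 a.
have : (1 + - a) * expR a <= 1 by rewrite -ler_pdivlMr// div1r.
lra.
Qed.

End TaylorBounds.

(** * Comparison of the two characteristic functions *)

Section CharacteristicFunctions.
Variables (K : realType) (qs : seq K) (c R : nat).
Implicit Types (w : K[i]) (x e y : K).

Definition power_sum j := \sum_(q <- qs) q ^+ j.

(* Characteristic function at [t] of [c] plus a sum of independent geometric
   variables with failure odds [qs], written in terms of [w = exp (i t) - 1]. *)
Definition waiting_cf w : K[i] :=
  (1 + w) ^+ c * \prod_(q <- qs) (1 - q%:C * w)^-1.

Definition h_eval w : K[i] :=
  - (power_sum 2 - c%:R)%:C * w + ((power_sum 2 - c%:R) / 2)%:C * w ^+ 2
  + \sum_(3 <= i < R.+1)
      ((power_sum i + (-1) ^+ i.+1 * c%:R) / i%:R)%:C * w ^+ i.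

Definition H_eval w : K[i] :=
  \sum_(0 <= l < R.+1) (l`!%:R)^-1 * h_eval w ^+ l.

Definition charlier_cf w : K[i] :=
  cexp ((power_sum 1 + power_sum 2)%:C * w) * H_eval w.

Hypothesis R3 : (3 <= R)%N.

(* The logarithm of [waiting_cf] truncated at order [R] is the exponent of
   [charlier_cf]; this is what dictates the definition of [h]. *)
Lemma sum_clog_poly w :
  \sum_(q <- qs) clog_poly R (q%:C * w) - clog_poly R (- w) *+ c =
  (power_sum 1 + power_sum 2)%:C * w + h_eval w.
Proof.
have -> : \sum_(q <- qs) clog_poly R (q%:C * w) - clog_poly R (- w) *+ c =
    \sum_(0 <= l < R) ((power_sum l.+1 + (-1) ^+ l.+2 * c%:R) / l.+1%:R)%:C
       * w ^+ l.+1.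
  rewrite /clog_poly exchange_big/= -sumrMnl -sumrB; apply: eq_bigr => l _.
  rewrite /power_sum rmorphM fmorphV rmorph_nat rmorphD rmorph_sum/=.
  rewrite -mulr_sumr.
  have -> : \sum_(q <- qs) (q%:C * w) ^+ l.+1 =
      (\sum_(q <- qs) (q ^+ l.+1)%:C) * w ^+ l.+1.
    by rewrite mulr_suml; apply: eq_bigr => q _; rewrite exprMn rmorphXn.
  rewrite rmorphM rmorphXn rmorphN rmorph1 rmorph_nat -[- w]mulN1r exprMn.
  rewrite -[_ *+ c]mulr_natr (exprS _ l.+1).
  by move: (l.+1%:R^-1) ((-1) ^+ l.+1) => a b; ring.
(* The linear coefficient [power_sum 1 + c] is [sigma^2 - (power_sum 2 - c)], the origin of the
   negative linear term of [h_eval]; all higher coefficients agree as they stand. *)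
rewrite /h_eval; case: R R3 => [|[|[|r]]]// _.
rewrite big_nat_recl// big_nat_recl// !big_add1/= !addrA; congr (_ + _).
rewrite expr1 divr1.
rewrite !(rmorphD, rmorphM, rmorphN, rmorph1, rmorph_nat, fmorphV, rmorphXn)/=.
by field.
Qed.

Variables (Q B : K).
Hypotheses (qs_ge0 : forall q, q \in qs -> 0 <= q)
           (qs_leQ : forall q, q \in qs -> q <= Q)
           (Q0 : 0 <= Q) (B1 : 1 <= B)
           (c_le : c%:R <= power_sum 2) (c_gt : power_sum 2 - c%:R <= 1).

Lemma power_sum_ge0 j : 0 <= power_sum j.
Proof. by rewrite /power_sum big_seq sumr_ge0// => q /qs_ge0 ?; nonneg. Qed.

(** * Comparison at one point [w]: [y] stands for [sigma * |w|], [e] is the expansion parameter *)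

Section AtPoint.
Variables (w : K[i]) (e y : K).
Let x := normc w.
Hypotheses (e0 : 0 <= e) (y0 : 0 <= y) (xe : (1 + Q) * x <= e)
  (a2e : power_sum 2 * x ^+ 2 <= B * e ^+ 2)
  (Bey : B * e ^+ 2 <= 16 * y ^+ 2).

Lemma normc_le_e : x <= e.
Proof.
by apply: le_trans xe; rewrite mulrDl mul1r lerDl; nonneg.
Qed.

(** Two powers of [x] are paid by [a2e], each further one by [(1 + Q) * x <= e]. Having [1 + Q] in
    place of [Q] lets the same estimate cover [c]. *)
Lemma power_sum_scaled_le i : (2 <= i)%N ->
  (power_sum i + c%:R) * x ^+ i <= 2 * B * e ^+ i.
Proof.
move=> i2.
have x0 : 0 <= x by nonneg.
rewrite -(subnK i2) addnC !exprD; set j := (i - 2)%N.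
have ai : power_sum (2 + j) <= power_sum 2 * (1 + Q) ^+ j.
  rewrite /power_sum mulr_suml big_seq [leRHS]big_seq; apply: ler_sum => q qqs.
  rewrite exprD ler_wpM2l ?exprn_ge0 ?qs_ge0//.
  have q0 := qs_ge0 qqs.
  rewrite lerXn2r ?nnegrE ?addr_ge0//.
  by rewrite (le_trans (qs_leQ qqs))// lerDr.
have ci : c%:R <= power_sum 2 * (1 + Q) ^+ j.
  rewrite (le_trans c_le)// ler_peMr ?power_sum_ge0//.
  by rewrite exprn_ege1// lerDl.
have h : ((1 + Q) * x) ^+ j <= e ^+ j.
  by rewrite lerXn2r// nnegrE; nonneg.
have := ler_pM _ _ a2e h.
rewrite exprMn => /(_ _ _)/le_trans h'.
apply: (@le_trans _ _ (2 * (power_sum 2 * x ^+ 2 * ((1 + Q) ^+ j * x ^+ j)))).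
  have : 0 <= x ^+ 2 * x ^+ j by nonneg.
  by move: ai ci; nra.
have -> : 2 * B * (e ^+ 2 * e ^+ j) = 2 * (B * e ^+ 2 * e ^+ j) by ring.
rewrite ler_wpM2l// h'//.
- by rewrite mulr_ge0 ?power_sum_ge0; nonneg.
- by nonneg.
Qed.

(** The first two coefficients involve only the fractional part [power_sum 2 - c], so they
    contribute no factor [B]: this is the effect of shifting by [c]. *)
Lemma h_eval_le : normc (h_eval w) <=
  e + e ^+ 2 + \sum_(3 <= i < R.+1) 2 * B * e ^+ i.
Proof.
have x0 : 0 <= x by nonneg.
have xe' := normc_le_e.
have d0 : 0 <= power_sum 2 - c%:R by rewrite subr_ge0.
rewrite /h_eval (le_trans (normcD_le _ _))// lerD//.
  rewrite (le_trans (normcD_le _ _))// lerD//.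
    rewrite mulNr normcN_eq Normc.normcM normc_real ger0_norm// -/x.
    by rewrite (le_trans _ xe')// ler_piMl.
  rewrite Normc.normcM normc_real ger0_norm; last by nonneg.
  rewrite normcX -/x (@le_trans _ _ (x ^+ 2))//; last first.
    by rewrite lerXn2r.
  by rewrite ler_piMl ?exprn_ge0// ler_pdivrMr// mul1r (le_trans c_gt) ?ler1n.
rewrite (le_trans (normc_sum_le _ _ _))// big_nat [leRHS]big_nat.
apply: ler_sum => i /andP[i3 _].
rewrite Normc.normcM normc_real normcX -/x.
apply: le_trans (power_sum_scaled_le (ltnW i3)); rewrite ler_wpM2r ?exprn_ge0//.
rewrite normrM normfV normr_nat.
have i1 : (1 : K) <= i%:R by rewrite ler1n (leq_trans _ i3).
rewrite ler_pdivrMr ?(lt_le_trans ltr01)//.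
apply: (@le_trans _ _ (power_sum i + c%:R)); last first.
  by rewrite ler_peMr// addr_ge0 ?power_sum_ge0.
rewrite (le_trans (ler_normD _ _))// normrM normrX normrN1 expr1n mul1r.
by rewrite !ger0_norm ?power_sum_ge0.
Qed.

Lemma normc_charlier_cf : normc (charlier_cf w) <=
  expR (complex.Re ((power_sum 1 + power_sum 2)%:C * w)) *
  \sum_(0 <= l < R.+1) normc (h_eval w) ^+ l.
Proof.
rewrite /charlier_cf Normc.normcM normc_cexp ler_wpM2l ?expR_ge0//.
rewrite (le_trans (normc_sum_le _ _ _))//; apply: ler_sum => l _.
rewrite Normc.normcM normcX normc_natV ler_piMl ?exprn_ge0 ?normc_ge0//.
by rewrite invf_le1 ?ler1n ?ltr0n ?fact_gt0.
Qed.

Hypotheses (e_small : e <= 512^-1)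
  (Rew : (power_sum 1 + power_sum 2) * complex.Re w = - (y ^+ 2 / 2)).

(** The sum is geometric of ratio [e], so at most [4 * B * e ^+ 3], and [Bey] converts [B * e ^+ 2]
    into [16 * y ^+ 2]. *)
Lemma h_eval_inner : normc (h_eval w) <= 64 * e * (1 + y ^+ 2).
Proof.
move: e_small e0 B1 y0 Bey => es e0' B1' y0' Bey'.
apply: (le_trans h_eval_le).
have -> : \sum_(3 <= i < R.+1) 2 * B * e ^+ i =
    2 * B * e ^+ 3 * \sum_(0 <= i < R.+1 - 3) e ^+ i.
  rewrite -[X in \sum_(X <= i < _) _]add0n big_addn mulr_sumr.
  by apply: eq_bigr => i _; rewrite exprD; ring.
have g : \sum_(0 <= i < R.+1 - 3) e ^+ i <= 2.
  by rewrite sum_geom_le2//; apply/andP; split=> //; lra.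
have Be3 : 0 <= 2 * B * e ^+ 3 by rewrite !mulr_ge0// ?exprn_ge0//; lra.
have := ler_wpM2l Be3 g.
have : B * e ^+ 2 * e <= 16 * y ^+ 2 * e by rewrite ler_wpM2r.
have : e ^+ 2 <= e by rewrite expr2 ler_piMl//; lra.
by rewrite (exprSr e 2); lra.
Qed.

(** After factoring out the common exponential, the difference is [cexp h * (P - 1) + (cexp h - H)],
    where [P] collects the Taylor errors of the logarithms. The threshold [512^-1] makes
    [64 * e <= 8^-1], so [cexp h] costs at most [expR ((1 + y ^+ 2) / 8)]; [P] costs at most
    [expR (y ^+ 2 / 8)]. Half of the Gaussian exponent survives. *)
Lemma sub_cf_inner : normc (waiting_cf w - charlier_cf w) <=
  expR (- (y ^+ 2 / 2)) * (expR (8^-1 + y ^+ 2 / 4) *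
   (32 * B * e ^+ R.+1 + 2 ^+ R.+1 * (64 * e * (1 + y ^+ 2)) ^+ R.+1)).
Proof.
have x0 : 0 <= x by nonneg.
have xe' := normc_le_e.
move: e_small e0 B1 y0 Bey => es e0' B1' y0' Bey'.
have hI := h_eval_inner.
have h8 : normc (h_eval w) <= 8^-1 * (1 + y ^+ 2).
  apply: (le_trans hI); rewrite ler_wpM2r ?addr_ge0 ?exprn_ge0//; lra.
(* Sum of the bounds of [clog_factor] over all odds and the [c] factors [1 + w]. *)
pose S := 16 * (power_sum R.+1 + c%:R) * x ^+ R.+1.
have S0 : 0 <= S by rewrite !mulr_ge0 ?addr_ge0 ?power_sum_ge0; nonneg.
have Se : S <= 32 * B * e ^+ R.+1.
  have R2 : (1 < R.+1)%N by rewrite ltnS (ltnW (ltnW R3)).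
  by have := power_sum_scaled_le R2; rewrite /S; lra.
have Sy : S <= y ^+ 2 / 8.
  apply: (le_trans Se); rewrite -(subnK R3) -addnS addnC exprD.
  have : e ^+ 4 * e ^+ (R - 3) <= e ^+ 4.
    by rewrite ler_piMr ?exprn_ge0// exprn_ile1//; lra.
  move=> /(ler_wpM2l (_ : 0 <= 32 * B)) h.
  apply: (le_trans (h _)); first by lra.
  have -> : 32 * B * e ^+ 4 = B * e ^+ 2 * (32 * (e * e)) by ring.
  have ee : 32 * (e * e) <= 128^-1.
    have : e * e <= 512^-1 * 512^-1 by rewrite ler_pM.
    by lra.
  have Be2 : 0 <= B * e ^+ 2 by rewrite mulr_ge0 ?exprn_ge0//; lra.
  have := ler_wpM2l Be2 ee; lra.
have qx q : q \in qs -> normc (q%:C * w) = q * x.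
  by move=> qqs; rewrite Normc.normcM normc_real ger0_norm ?qs_ge0.
have qx4 q : q \in qs -> normc (q%:C * w) <= 4^-1.
  move=> qqs; rewrite qx//; apply: (@le_trans _ _ e); last by lra.
  apply: le_trans xe; rewrite ler_wpM2r// (le_trans (qs_leQ qqs))//.
  by rewrite lerDr.
have [E [EP1 EP2]] : exists E : K -> K[i],
    (forall q, q \in qs -> (1 - q%:C * w)^-1 =
       cexp (clog_poly R (q%:C * w)) * (1 + E q)) /\
    (forall q, q \in qs -> normc (E q) <= 16 * (q * x) ^+ R.+1).
  have F q : exists E, q \in qs -> (1 - q%:C * w)^-1 =
       cexp (clog_poly R (q%:C * w)) * (1 + E) /\
       normc E <= 16 * (q * x) ^+ R.+1.
    case: (boolP (q \in qs)) => [qqs|_]; last by exists 0.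
    have [[E h1 h2] _] := clog_factor (ltnW R3) (qx4 _ qqs).
    by exists E => _; split=> //; rewrite -qx.
  have [E EP] := choice F.
  by exists E; split=> q /EP[].
have [_ [E' E'1 E'2]] : (exists2 e0, (1 - - w)^-1 =
     cexp (clog_poly R (- w)) * (1 + e0) &
   normc e0 <= 16 * normc (- w) ^+ R.+1) /\ (exists2 e0, 1 - - w =
     cexp (- clog_poly R (- w)) * (1 + e0) &
   normc e0 <= 16 * normc (- w) ^+ R.+1).
  by apply: clog_factor; rewrite ?(ltnW R3)// normcN_eq -/x; lra.
rewrite opprK in E'1; rewrite normcN_eq -/x in E'2.
pose P := (1 + E') ^+ c * \prod_(q <- qs) (1 + E q).
have muE : waiting_cf w =
    cexp ((power_sum 1 + power_sum 2)%:C * w) * (cexp (h_eval w) * P).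
  rewrite mulrA -cexpD -sum_clog_poly cexpD -mulNrn cexpMn.
  rewrite /waiting_cf E'1 exprMn /P.
  have -> : \prod_(q <- qs) (1 - q%:C * w)^-1 =
     cexp (\sum_(q <- qs) clog_poly R (q%:C * w)) * \prod_(q <- qs) (1 + E q).
    rewrite (big_morph (@cexp K) (@cexpD K) (@cexp0 K)) -big_split/=.
    by rewrite big_seq [RHS]big_seq; apply: eq_bigr => q /EP1.
  by rewrite mulrACA [X in X * _]mulrC; ring.
have P1 : normc (P - 1) <= expR S - 1.
  have -> : S = \sum_(i < c) 16 * x ^+ R.+1
              + \sum_(q <- qs) 16 * (q * x) ^+ R.+1.
    rewrite sumr_const card_ord -mulr_natl /S -mulr_sumr.
    have -> : \sum_(q <- qs) (q * x) ^+ R.+1 = power_sum R.+1 * x ^+ R.+1.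
      by rewrite mulr_suml; apply: eq_bigr => q _; rewrite exprMn.
    by ring.
  apply: normc1DM.
  - by apply: sumr_ge0 => i _; nonneg.
  - by rewrite big_seq; apply: sumr_ge0 => q /qs_ge0 ?; nonneg.
  - rewrite -[X in _ ^+ X](card_ord c) -prodr_const.
    apply: normc_prod1D => i; first by nonneg.
    by rewrite (le_trans (normc1D_expR _))// lerB// ler_expR.
  - rewrite big_seq [X in expR X]big_seq -big_filter -[X in expR X]big_filter.
    have -> : [seq i <- qs | i \in qs] = qs by apply/all_filterP/allP.
    (* [normc_prod1D] asks for its bound at every index, so the factors are replaced by 1 outside
       [qs]. *)
    rewrite (_ : \prod_(q <- qs) _ =
       \prod_(q <- qs) (if q \in qs then 1 + E q else 1)); last first.
      by rewrite big_seq [RHS]big_seq; apply: eq_bigr => q ->.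
    rewrite (_ : \sum_(q <- qs) _ =
       \sum_(q <- qs) (if q \in qs then 16 * (q * x) ^+ R.+1 else 0)); last first.
      by rewrite big_seq [RHS]big_seq; apply: eq_bigr => q ->.
    apply: normc_prod1D => q; case: ifPn => // qqs.
    + by have := qs_ge0 qqs => ?; nonneg.
    + by rewrite (le_trans (normc1D_expR _))// lerB// ler_expR EP2.
    + by rewrite subrr Normc.normc0 expR0 subrr.
have PS : normc (P - 1) <= S * expR S by apply: le_trans (expR_sub1_le _).
rewrite muE /charlier_cf -mulrBr Normc.normcM normc_cexp.
have -> : complex.Re ((power_sum 1 + power_sum 2)%:C * w) = - (y ^+ 2 / 2).
  by rewrite ReM/= mul0r subr0.
rewrite ler_wpM2l ?expR_ge0//.
have -> : cexp (h_eval w) * P - H_eval w =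
    cexp (h_eval w) * (P - 1) + (cexp (h_eval w) - H_eval w) by ring.
rewrite (le_trans (normcD_le _ _))// [leRHS]mulrDr lerD//.
  rewrite (Normc.normcM (cexp _)).
  have -> : expR (8^-1 + y ^+ 2 / 4) =
      expR (8^-1 * (1 + y ^+ 2)) * expR (y ^+ 2 / 8).
    by rewrite -expRD; congr expR; lra.
  rewrite -mulrA ler_pM//; [nonneg|nonneg| |].
    by rewrite (le_trans (normc_cexp_le _))// ler_expR.
  by apply: (le_trans PS); rewrite mulrC ler_pM// ?ler_expR//; nonneg.
apply: (le_trans (cexp_taylor _ _)).
have y2 : 0 <= y ^+ 2 by nonneg.
rewrite mulrC; apply: ler_pM; [nonneg|nonneg| |].
  by rewrite ler_expR; apply: (le_trans h8); lra.
rewrite ler_wpM2l; [by []|by nonneg|].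
by rewrite lerXn2r ?nnegrE ?normc_ge0 ?(le_trans _ hI) ?normc_ge0.
Qed.

End AtPoint.

End CharacteristicFunctions.

Ltac pos := repeat first
  [ done | exact: expR_gt0 | by rewrite ltr0n | apply: exprn_gt0
  | apply: mulr_gt0 | apply: addr_gt0 | apply: divr_gt0 | rewrite invr_gt0 ].

(** * Pointwise error bounds, for [w] near 0 and away from 0 *)

Section PointwiseBound.
Variable K : realType.
Implicit Types (qs : seq K) (w : K[i]).

(** With [x = a * (1 + v)] one has [x ^+ M <= M! * expR x]; dividing by [a ^+ M] gives the
    constant. *)
Lemma poly_le_expR (M : nat) (a : K) : 0 < a ->
  exists2 C, 0 < C & forall v, 0 <= v -> (1 + v) ^+ M <= C * expR (a * v).
Proof.
move=> a0; exists (a^-1 ^+ M * M`!%:R * expR a) => [|v v0].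
  by rewrite !mulr_gt0 ?exprn_gt0 ?invr_gt0 ?expR_gt0 ?ltr0n ?fact_gt0.
have aM : 0 <= a^-1 ^+ M by rewrite exprn_ge0 ?invr_ge0 ?ltW.
have x0 : 0 <= a + a * v by nonneg.
have h : (a + a * v) ^+ M <= M`!%:R * expR (a + a * v).
  case: M {aM} => [|M].
    by rewrite expr0 fact0 mul1r -[leLHS]expR0 ler_expR.
  rewrite [leRHS]mulrC -ler_pdivrMr ?ltr0n ?fact_gt0//.
  by rewrite (le_trans _ (expR_ge1Dxn M x0))// lerDr.
rewrite -!mulrA -expRD.
apply: le_trans (ler_wpM2l aM h).
by rewrite -exprMn mulrDr mulrA mulVf ?mul1r ?gt_eqF.
Qed.

Lemma sum_expr_le (X Y : K) (n : nat) : 0 <= X -> X <= Y -> 1 <= Y ->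
  \sum_(0 <= l < n.+1) X ^+ l <= n.+1%:R * Y ^+ n.
Proof.
move=> X0 XY Y1.
have -> : n.+1%:R * Y ^+ n = \sum_(0 <= l < n.+1) Y ^+ n.
  by rewrite sumr_const_nat subn0 mulr_natl.
rewrite big_nat [leRHS]big_nat; apply: ler_sum => l /andP[_ ln].
apply: (@le_trans _ _ (Y ^+ l)); last by rewrite ler_weXn2l.
by rewrite lerXn2r ?nnegrE ?(le_trans X0 XY).
Qed.

(** On the circle [normc (1 + w) = 1] the squared modulus of [1 - q w] is [1 + q (1 + q) |w|^2].
    Lowering [|w|] to [x0] brings the increment [u] into [[0, 1]], where [1 + u >= expR (u / 2)]. *)
Lemma normc_waiting_cf_le qs (c : nat) w (Q x0 : K) :
  (forall q, q \in qs -> 0 <= q) -> (forall q, q \in qs -> q <= Q) ->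
  normc (1 + w) = 1 -> 0 <= x0 <= normc w -> (1 + Q) * x0 <= 1 ->
  normc (waiting_cf qs c w) <=
  expR (- ((power_sum qs 1 + power_sum qs 2) * x0 ^+ 2 / 4)).
Proof.
move=> q0 qQ w1 /andP[x00 x0x] Qx0.
rewrite -(@ler_pXn2r _ 2) ?nnegrE ?normc_ge0 ?expR_ge0//.
rewrite Normc.normcM normcX w1 expr1n mul1r normc_prod -prodrXl -expRM_natl.
rewrite (_ : 2 * - _ = \sum_(q <- qs) (- (q * (1 + q) * x0 ^+ 2 / 2))); last first.
  rewrite sumrN -!mulr_suml.
  have -> : \sum_(q <- qs) q * (1 + q) = power_sum qs 1 + power_sum qs 2.
    by rewrite -big_split/=; apply: eq_bigr => q _; ring.
  by field.
rewrite (big_morph (@expR K) (@expRD K) (@expR0 K)).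
rewrite big_seq [leRHS]big_seq; apply: ler_prod => q qqs.
rewrite exprn_ge0 ?normc_ge0//=.
have q0' := q0 _ qqs; have qQ' := qQ _ qqs.
rewrite Normc.normcV exprVn.
have -> : normc (1 - q%:C * w) ^+ 2 = 1 + q * (1 + q) * normc w ^+ 2.
  have : normc (1 + w) ^+ 2 = 1 by rewrite w1 expr1n.
  rewrite !sqr_normcE; case: w {w1 x0x} => a b /= ab.
  have ab' : a ^+ 2 + b ^+ 2 = - 2 * a by lra.
  transitivity (1 - 2 * q * a + q ^+ 2 * (a ^+ 2 + b ^+ 2)); first by ring.
  by rewrite ab'; ring.
set u := q * (1 + q) * x0 ^+ 2.
have u0 : 0 <= u by rewrite /u; nonneg; lra.
have u1 : u <= 1.
  have h : (1 + q) * x0 <= 1.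
    by apply: le_trans Qx0; rewrite ler_wpM2r// lerD2l.
  have h0 : 0 <= (1 + q) * x0 by nonneg.
  have : (1 + q) * x0 * ((1 + q) * x0) <= 1.
    by rewrite -[leRHS]mulr1 ler_pM.
  by rewrite /u expr2; nra.
have : 1 + u <= 1 + q * (1 + q) * normc w ^+ 2.
  rewrite lerD2l ler_wpM2l//; first by nonneg.
  by rewrite lerXn2r ?nnegrE ?normc_ge0.
move=> uw.
rewrite -[leRHS]invrK lef_pV2 ?posrE ?invr_gt0 ?expR_gt0 ?(lt_le_trans _ uw)//; last by lra.
rewrite (le_trans _ uw)// -expRN opprK.
have := expR_ge1Dx (- (u / 2)); rewrite expRN => h.
have ep := expR_gt0 (u / 2).
have : (1 - u / 2) * expR (u / 2) <= 1 by rewrite -ler_pdivlMr// div1r.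
by nra.
Qed.

Lemma gauss_le_power (n : nat) (a : K) : 0 < a -> exists2 C : K, 0 < C &
  forall B rho : K, 1 <= B -> 0 <= rho ->
  expR (- (a * rho ^+ 2)) * rho ^+ n <= C * B.
Proof.
move=> a0; have [C C0 hC] := poly_le_expR n a0.
exists C => // B rho B1 r0; rewrite expRN [leLHS]mulrC ler_pdivrMr ?expR_gt0//.
have r1v : rho <= 1 + rho ^+ 2 by rewrite expr2; nra.
have r2 : 0 <= rho ^+ 2 by nonneg.
apply: (@le_trans _ _ ((1 + rho ^+ 2) ^+ n)).
  by rewrite lerXn2r// nnegrE; nonneg.
apply: (le_trans (hC _ r2)); rewrite ler_wpM2r ?expR_ge0//.
by rewrite ler_peMr// ltW.
Qed.

(** The surviving [expR (- y ^+ 2 / 4)] absorbs [(n + n).+1] powers of [1 + y ^+ 2]: [n] from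
    [e ^+ n], [n] from the bound on [h_eval], and one kept as the summable kernel. *)
Lemma inner_remainder_le (n : nat) : exists2 C : K, 0 < C &
  forall B y rho e : K, 1 <= B -> 0 <= y -> 0 < rho -> e = 4 * y / rho ->
  expR (- (y ^+ 2 / 2)) * (expR (8^-1 + y ^+ 2 / 4) *
    (32 * B * e ^+ n + 2 ^+ n * (64 * e * (1 + y ^+ 2)) ^+ n)) <=
  C * (B / rho ^+ n / (1 + y ^+ 2)).
Proof.
have [C1 C10 hC1] := @poly_le_expR (n + n).+1 4^-1 ltac:(by []).
pose D : K := 32 * 4 ^+ n + (2 * 64 * 4) ^+ n.
have D0 : 0 < D by rewrite /D; pos.
exists (expR 8^-1 * D * C1) => [|B y rho e B1 y0 r0 eE]; first by pos.
have v0 : 0 <= y ^+ 2 by nonneg.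
have yv : y <= 1 + y ^+ 2 by rewrite expr2; nra.
move: (y ^+ 2) v0 yv => v v0 yv.
have Y1 : 1 <= 1 + v by rewrite lerDl.
have Y0 : 0 < 1 + v by rewrite (lt_le_trans ltr01).
have B0 : 0 <= B by rewrite (le_trans ler01).
have rn0 : 0 <= (rho ^+ n)^-1 by nonneg.
have eR : e ^+ n <= 4 ^+ n / rho ^+ n * (1 + v) ^+ n.
  rewrite eE expr_div_n exprMn mulrAC ler_wpM2l//; first by nonneg.
  by rewrite lerXn2r// nnegrE ltW.
have X1 : 1 <= (1 + v) ^+ n by rewrite exprn_ege1.
have h1 : 32 * B * e ^+ n + 2 ^+ n * (64 * e * (1 + v)) ^+ n <=
    D * (B / rho ^+ n * (1 + v) ^+ (n + n)).
  rewrite -exprMn mulrA (mulrA 2) !exprMn exprD /D !exprMn [2 ^+ n * (_ * e ^+ n)]mulrA.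
  move: eR X1 rn0.
  have p1 : 0 <= 2 ^+ n * 64 ^+ n :> K by nonneg.
  have p2 : 0 <= 4 ^+ n :> K by nonneg.
  move: p1 p2; move: (e ^+ n) (2 ^+ n * 64 ^+ n) (4 ^+ n : K) ((rho ^+ n)^-1) ((1 + v) ^+ n).
  move=> E p q s X p0 q0 EX X1 s0.
  have X0 : 0 <= X by lra.
  have W0 : 0 <= q * s * X by nonneg.
  have -> : (32 * q + p * q) * (B * s) * (X * X) =
      32 * q * (B * s * (X * X)) + p * q * (B * s * (X * X)) by ring.
  apply: lerD.
    apply: (@le_trans _ _ (32 * B * (q * s * X))); first by rewrite ler_wpM2l//; nonneg.
    have -> : 32 * q * (B * s * (X * X)) = 32 * B * (q * s * X) * X by ring.
    by rewrite ler_peMr//; nonneg.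
  apply: (@le_trans _ _ (p * (q * s * X) * X)).
    by rewrite ler_wpM2r// ler_wpM2l.
  have -> : p * q * (B * s * (X * X)) = p * (q * s * X) * X * B by ring.
  by rewrite ler_peMr//; nonneg.
have hY : (1 + v) ^+ (n + n) <= C1 * expR (4^-1 * v) / (1 + v).
  by rewrite ler_pdivlMr// -exprSr hC1.
rewrite mulrA -expRD.
have -> : - (v / 2) + (8^-1 + v / 4) = 8^-1 + - (4^-1 * v) by lra.
rewrite expRD expRN mulrAC ler_pdivrMr ?expR_gt0//.
apply: (le_trans (ler_wpM2l (expR_ge0 _) h1)).
have c0 : 0 <= expR 8^-1 * D * (B / rho ^+ n).
  by rewrite mulr_ge0 ?mulr_ge0 ?expR_ge0// ltW.
have := ler_wpM2l c0 hY.
set E := expR _; set F := expR _; set y1 := (1 + v)^-1; set y2 := _ ^+ (_ + _).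
set br := B / _.
have -> : E * D * C1 * (br * y1) * F = E * D * br * (C1 * F * y1) by ring.
by have -> : E * (D * (br * y2)) = E * D * br * y2 by ring.
Qed.

(** Here [h_eval] need not be small, but [rho <= L * y] bounds [rho], [B] and [e] by powers of
    [1 + y ^+ 2], and the Gaussian factor beats any such power. *)
Lemma outer_charlier_le (n : nat) (L : K) : 1 <= L -> exists2 C : K, 0 < C &
  forall B y rho e H : K, 1 <= rho -> 1 <= B -> B <= rho ^+ 2 -> 0 <= y ->
  rho <= L * y -> e = 4 * y / rho -> 0 <= H ->
  H <= e + e ^+ 2 + \sum_(3 <= i < n.+1) 2 * B * e ^+ i ->
  expR (- (y ^+ 2 / 2)) * (\sum_(0 <= l < n.+1) H ^+ l) * rho ^+ n.+2 <= C * B.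
Proof.
move=> L1; have L0 : 0 < L by rewrite (lt_le_trans ltr01).
(* [H] grows at most like the power [n.+2] of [1 + v] and is raised up to the power [n];
   [rho ^+ n.+2] brings another [n.+2]. *)
have [C3 C30 hC3] := @poly_le_expR (n.+2 + n.+2 * n) 2^-1 ltac:(by []).
pose D : K := 20 + n%:R * (2 * L ^+ 2 * 4 ^+ n).
have D1 : 1 <= D.
  by rewrite /D -[leLHS]addr0 lerD ?ler1n//; nonneg.
have D0 : 0 < D by rewrite (lt_le_trans ltr01).
exists (L ^+ n.+2 * (n.+1%:R * D ^+ n) * C3).
  by pos.
move=> B y rho e H r1 B1 Br y0 yL eE H0 Hle.
have v0 : 0 <= y ^+ 2 by nonneg.
have yv : y <= 1 + y ^+ 2 by rewrite expr2; nra.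
have r0 : 0 < rho by rewrite (lt_le_trans ltr01).
have e0 : 0 <= e by rewrite eE; nonneg.
have er : e * rho = 4 * y by rewrite eE divfK ?gt_eqF.
move: (y ^+ 2) v0 yv => v v0 yv.
have Y1 : 1 <= 1 + v by rewrite lerDl.
have Y0 : 0 <= 1 + v by rewrite (le_trans ler01).
have rLY : rho <= L * (1 + v) by apply: (le_trans yL); rewrite ler_wpM2l// ltW.
have e4 : e <= 4 * (1 + v).
  apply: (@le_trans _ _ (4 * y)); last by rewrite ler_wpM2l.
  by rewrite -er ler_peMr.
have BY : B <= L ^+ 2 * (1 + v) ^+ 2.
  apply: (le_trans Br); rewrite -exprMn lerXn2r ?nnegrE//; first exact: ltW.
  by rewrite mulr_ge0// ltW.
have hD : H <= D * (1 + v) ^+ n.+2.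
  apply: (le_trans Hle); rewrite /D [leRHS]mulrDl lerD//.
    have e2 : e ^+ 2 <= 16 * (1 + v) ^+ 2.
      have -> : 16 * (1 + v) ^+ 2 = (4 * (1 + v)) ^+ 2 by ring.
      by rewrite lerXn2r// nnegrE; nonneg.
    have Y2 : (1 + v) ^+ 1 <= (1 + v) ^+ n.+2 by rewrite ler_weXn2l.
    have Y3 : (1 + v) ^+ 2 <= (1 + v) ^+ n.+2 by rewrite ler_weXn2l.
    move: e4 e2 Y2 Y3; rewrite expr1; clear; lra.
  apply: (@le_trans _ _ (\sum_(3 <= i < n.+1) 2 * L ^+ 2 * 4 ^+ n * (1 + v) ^+ n.+2)).
    rewrite big_nat [leRHS]big_nat; apply: ler_sum => i /andP[i3 iR].
    have eY : e ^+ i <= 4 ^+ n * (1 + v) ^+ n.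
      rewrite -exprMn; apply: (@le_trans _ _ ((4 * (1 + v)) ^+ i)).
        by rewrite lerXn2r// nnegrE; nonneg.
      rewrite ler_weXn2l//; by move: Y1; clear; lra.
    have -> : 2 * L ^+ 2 * 4 ^+ n * (1 + v) ^+ n.+2 =
       2 * (L ^+ 2 * (1 + v) ^+ 2) * (4 ^+ n * (1 + v) ^+ n).
      have -> : (1 + v) ^+ n.+2 = (1 + v) ^+ 2 * (1 + v) ^+ n by rewrite -exprD.
      by ring.
    have B0 : 0 <= B by rewrite (le_trans ler01).
    by apply: ler_pM; [nonneg|nonneg|rewrite ler_wpM2l|].
  rewrite sumr_const_nat -[leLHS]mulr_natl.
  rewrite -[leRHS]mulrA ler_wpM2r//; first by nonneg.
  by rewrite ler_nat subSS leq_subr.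
have DY : 1 <= D * (1 + v) ^+ n.+2.
  by rewrite -[leLHS]mulr1 ler_pM ?exprn_ege1.
have hS : \sum_(0 <= l < n.+1) H ^+ l <=
    n.+1%:R * D ^+ n * (1 + v) ^+ (n.+2 * n).
  apply: (le_trans (sum_expr_le n H0 hD DY)).
  by rewrite -mulrA exprM -exprMn.
have rY : rho ^+ n.+2 <= L ^+ n.+2 * (1 + v) ^+ n.+2.
  rewrite -exprMn lerXn2r ?nnegrE//; first exact: ltW.
  by rewrite mulr_ge0// ltW.
have S0 : 0 <= \sum_(0 <= l < n.+1) H ^+ l by nonneg.
rewrite -mulrA expRN [leLHS]mulrC ler_pdivrMr ?expR_gt0//.
apply: (le_trans (ler_pM S0 (exprn_ge0 _ (ltW r0)) hS rY)).
have K0 : 0 <= L ^+ n.+2 * (n.+1%:R * D ^+ n).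
  by nonneg; apply: ltW.
have := ler_wpM2l K0 (hC3 _ v0); rewrite exprD (mulrC 2^-1) => h.
apply: (@le_trans _ _ (L ^+ n.+2 * (n.+1%:R * D ^+ n) * (C3 * expR (v / 2)))).
  by apply: le_trans h; rewrite le_eqVlt; apply/orP; left; apply/eqP; ring.
have F0 : 0 <= C3 * expR (v / 2) by nonneg.
move: (L ^+ n.+2 * (n.+1%:R * D ^+ n)) K0 {h} => k K0.
have -> : k * C3 * B * expR (v / 2) = k * (C3 * expR (v / 2)) * B by ring.
by rewrite ler_peMr// mulr_ge0.
Qed.

(* The terms of [h_eval] at [w] are of order [B * (sigma * normc w / rho) ^+ i].
   For [m < n / 2] the parameters are [rho = sqrt m] and [B = m], otherwise
   [rho = sigma] and [B = coupon_a 2]. *)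
Record cf_scaling qs (c : nat) (Q B rho sigma : K) : Prop := CfScaling {
  scaling_ge0 : forall q, q \in qs -> 0 <= q;
  scaling_leQ : forall q, q \in qs -> q <= Q;
  scaling_Q0 : 0 <= Q;
  scaling_c : c%:R <= power_sum qs 2;
  scaling_c1 : power_sum qs 2 - c%:R <= 1;
  scaling_sigma : 0 < sigma;
  scaling_sigmaE : sigma ^+ 2 = power_sum qs 1 + power_sum qs 2;
  scaling_rho : 1 <= rho;
  scaling_B : 1 <= B;
  scaling_Brho : B <= rho ^+ 2;
  scaling_a2 : power_sum qs 2 * rho ^+ 2 <= B * sigma ^+ 2;
  scaling_Q : (1 + Q) * rho <= 4 * sigma }.

Section Scaled.
Variables (qs : seq K) (c : nat) (Q B rho sigma : K) (w : K[i]).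
Hypotheses (sc : cf_scaling qs c Q B rho sigma) (w1 : normc (1 + w) = 1).
Let x := normc w.
Let y := sigma * x.
Let e := 4 * y / rho.

Let r0 : 0 < rho. Proof. exact: lt_le_trans (scaling_rho sc). Qed.
Let s0 := scaling_sigma sc.
Let x0 : 0 <= x. Proof. exact: normc_ge0. Qed.

Lemma scaled_xe : (1 + Q) * x <= e.
Proof.
rewrite /e ler_pdivlMr// /y mulrAC mulrA ler_wpM2r//; exact: scaling_Q sc.
Qed.

Lemma scaled_a2e : power_sum qs 2 * x ^+ 2 <= B * e ^+ 2.
Proof.
have B0 : 0 <= B by rewrite (le_trans ler01)// (scaling_B sc).
rewrite /e expr_div_n [leRHS]mulrA ler_pdivlMr ?exprn_gt0// mulrAC.
apply: (@le_trans _ _ (B * sigma ^+ 2 * x ^+ 2)).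
  by rewrite ler_wpM2r ?exprn_ge0 ?(scaling_a2 sc).
have y0 : 0 <= y by rewrite mulr_ge0// ltW.
have y4 : 0 <= 4 * y by rewrite mulr_ge0.
rewrite -mulrA -exprMn -/y ler_wpM2l// lerXn2r ?nnegrE//.
by rewrite ler_peMl// ler1n.
Qed.

Lemma scaled_Bey : B * e ^+ 2 <= 16 * y ^+ 2.
Proof.
rewrite /e expr_div_n [leLHS]mulrA ler_pdivrMr ?exprn_gt0// exprMn mulrC.
have -> : (4 : K) ^+ 2 = 16 by ring.
by rewrite ler_wpM2l ?(scaling_Brho sc)// mulr_ge0 ?sqr_ge0.
Qed.

(** On the unit circle around -1, [|w|^2 = - 2 Re w]; this is the source of the Gaussian factor. *)
Lemma scaled_Re :
  (power_sum qs 1 + power_sum qs 2) * complex.Re w = - (y ^+ 2 / 2).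
Proof.
rewrite -(scaling_sigmaE sc) /y exprMn.
have : normc (1 + w) ^+ 2 = 1 by rewrite w1 expr1n.
rewrite /x !sqr_normcE; case: (w) => a b /= ab.
have -> : a ^+ 2 + b ^+ 2 = - 2 * a by lra.
by field.
Qed.

End Scaled.

Lemma sub_cf_inner_le (R : nat) : (3 <= R)%N -> exists2 C : K, 0 < C &
  forall qs (c : nat) (Q B rho sigma : K) w, cf_scaling qs c Q B rho sigma ->
  normc (1 + w) = 1 -> 4 * (sigma * normc w) / rho <= 512^-1 ->
  normc (waiting_cf qs c w - charlier_cf qs c R w) <=
  C * (B / rho ^+ R.+1 / (1 + (sigma * normc w) ^+ 2)).
Proof.
move=> R3; have [C C0 hC] := inner_remainder_le R.+1.
exists C => // qs c Q B rho sigma w sc w1 es.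
have r0 : 0 < rho by exact: lt_le_trans (scaling_rho sc).
have y0 : 0 <= sigma * normc w by rewrite mulr_ge0 ?normc_ge0 ?(ltW (scaling_sigma sc)).
have e0 : 0 <= 4 * (sigma * normc w) / rho by rewrite divr_ge0 ?(ltW r0)// mulr_ge0.
apply: le_trans (hC B _ _ _ (scaling_B sc) y0 r0 erefl).
by apply: (sub_cf_inner R3 (scaling_ge0 sc) (scaling_leQ sc) (scaling_Q0 sc)
  (scaling_B sc) (scaling_c sc) (scaling_c1 sc) e0 y0 (scaled_xe w sc)
  (scaled_a2e w sc) (scaled_Bey w sc) es (scaled_Re sc w1)).
Qed.

Lemma sub_cf_outer_le (R : nat) : (3 <= R)%N -> exists2 C : K, 0 < C &
  forall qs (c : nat) (Q B rho sigma : K) w, cf_scaling qs c Q B rho sigma ->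
  normc (1 + w) = 1 -> 512^-1 < 4 * (sigma * normc w) / rho ->
  normc (waiting_cf qs c w - charlier_cf qs c R w) <= C * (B / rho ^+ R.+2).
Proof.
move=> R3.
(* [L] is 2048, abstracted because [done] would compute with the numeral *)
have [L [L4 LE]] : exists L : K, 4 <= L /\
    forall r y : K, 512^-1 * r <= 4 * y -> r <= L * y.
  by exists 2048; split=> [|r y h]; lra.
have L1 : 1 <= L by lra.
have L0 : 0 < L by lra.
(* The decay rate given by [normc_waiting_cf_le] at [x0 = rho / (L * sigma)]; its condition
   [(1 + Q) * x0 <= 1] is where [4 <= L] enters. *)
pose a : K := (4 * L ^+ 2)^-1.
have a0 : 0 < a by rewrite /a invr_gt0 mulr_gt0 ?exprn_gt0.
have [C2 C20 hC2] := gauss_le_power R.+2 a0.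
have [C5 C50 hC5] := outer_charlier_le R L1.
exists (C2 + C5); first by rewrite addr_gt0.
move=> qs c Q B rho sigma w sc w1 es.
have r1 := scaling_rho sc; have s0 := scaling_sigma sc.
have B1 := scaling_B sc.
have r0 : 0 < rho by rewrite (lt_le_trans ltr01).
have y0 : 0 <= sigma * normc w by rewrite mulr_ge0 ?normc_ge0 ?(ltW s0).
have e0 : 0 <= 4 * (sigma * normc w) / rho by rewrite divr_ge0 ?(ltW r0)// mulr_ge0.
have yL : rho <= L * (sigma * normc w).
  by apply: LE; move: es; rewrite ltr_pdivlMr// => /ltW.
rewrite mulrA ler_pdivlMr ?exprn_gt0// mulrDl.
apply: (le_trans (ler_wpM2r (exprn_ge0 _ (ltW r0)) (normcB_le _ _))).
rewrite mulrDl lerD//.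
  apply: le_trans (hC2 B rho B1 (ltW r0)).
  rewrite ler_wpM2r ?exprn_ge0 ?(ltW r0)//.
  have := @normc_waiting_cf_le qs c w Q (rho / (L * sigma)) (scaling_ge0 sc)
    (scaling_leQ sc) w1.
  rewrite -(scaling_sigmaE sc).
  have -> : sigma ^+ 2 * (rho / (L * sigma)) ^+ 2 / 4 = a * rho ^+ 2.
    by rewrite /a; field; rewrite !gt_eqF.
  apply.
    rewrite divr_ge0 ?(ltW r0) ?mulr_ge0 ?(ltW L0) ?(ltW s0)//=.
    rewrite ler_pdivrMr ?mulr_gt0//.
    by have -> : normc w * (L * sigma) = L * (sigma * normc w) by ring.
  rewrite mulrA ler_pdivrMr ?mulr_gt0// mul1r.
  by apply: (le_trans (scaling_Q sc)); rewrite ler_wpM2r// ltW.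
apply: le_trans (hC5 B _ _ _ _ r1 B1 (scaling_Brho sc) y0 yL erefl (normc_ge0 _)
  (h_eval_le R (scaling_ge0 sc) (scaling_leQ sc) (scaling_Q0 sc) (scaling_c sc)
    (scaling_c1 sc) e0 (scaled_xe w sc) (scaled_a2e w sc))).
rewrite ler_wpM2r ?exprn_ge0 ?(ltW r0)//.
apply: (le_trans (normc_charlier_cf _ _ _ _)).
by rewrite ReM/= mul0r subr0 (scaled_Re sc w1).
Qed.

Lemma sub_cf_le (R : nat) : (3 <= R)%N -> exists2 C : K, 0 < C &
  forall qs (c : nat) (Q B rho sigma : K) w, cf_scaling qs c Q B rho sigma ->
  normc (1 + w) = 1 ->
  normc (waiting_cf qs c w - charlier_cf qs c R w) <=
  C * (B / rho ^+ R.+1 / (1 + (sigma * normc w) ^+ 2) + B / rho ^+ R.+2).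
Proof.
move=> R3; have [C1 C10 hC1] := sub_cf_inner_le R3.
have [C2 C20 hC2] := sub_cf_outer_le R3.
exists (C1 + C2) => [|qs c Q B rho sigma w sc w1]; first by rewrite addr_gt0.
have B0 : 0 <= B by rewrite (le_trans ler01)// (scaling_B sc).
have r0 : 0 <= rho by rewrite (le_trans ler01)// (scaling_rho sc).
have T1 : 0 <= B / rho ^+ R.+1 / (1 + (sigma * normc w) ^+ 2).
  by rewrite !divr_ge0 ?exprn_ge0 ?addr_ge0 ?sqr_ge0.
have T2 : 0 <= B / rho ^+ R.+2 by rewrite divr_ge0 ?exprn_ge0.
have [es|es] := leP (4 * (sigma * normc w) / rho) 512^-1.
  apply: (le_trans (hC1 _ _ _ _ _ _ _ sc w1 es)).
  by apply: ler_pM; rewrite ?lerDl ?(ltW C10) ?(ltW C20).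
apply: (le_trans (hC2 _ _ _ _ _ _ _ sc w1 es)).
by apply: ler_pM; rewrite ?lerDr ?(ltW C20) ?(ltW C10).
Qed.

End PointwiseBound.

(** * Discrete Fourier inversion *)

Section RootsOfUnity.
Variable K : realType.
Implicit Types (t x : K).

Definition cis t : K[i] := cexp (0 +i* t).

Lemma cisD t x : cis (t + x) = cis t * cis x.
Proof. by rewrite /cis -cexpD; congr cexp; simpc. Qed.

Lemma cisMn t n : cis (t * n%:R) = cis t ^+ n.
Proof.
elim: n => [|n IH]; first by rewrite mulr0 expr0 /cis; exact: cexp0.
by rewrite -natr1 mulrDr mulr1 cisD IH exprSr.
Qed.

Lemma cis_2pi : cis (2 * pi) = 1.
Proof.
rewrite /cis /cexp/= expR0 mul1r.
have -> : 2 * pi = pi *+ 2 :> K by rewrite mulr_natl.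
by rewrite cos2pi sin2pi.
Qed.

Lemma normc_cis1 t : normc (cis t - 1) = 2 * `|sin (t / 2)|.
Proof.
apply/eqP; rewrite -(@eqrXn2 _ 2) ?normc_ge0 ?mulr_ge0//.
rewrite sqr_normcE exprMn real_normK ?num_real// /cis /cexp/= expR0 !mul0r.
rewrite !mul1r subr0 addr0 subr0.
have -> : cos t = 1 - 2 * sin (t / 2) ^+ 2.
  have {1}-> : t = (t / 2) *+ 2 by rewrite -mulr_natr divfK.
  by rewrite cos_mulr2n cos2sin2 -mulr_natl; ring.
have -> : sin t ^+ 2 = 4 * (sin (t / 2) ^+ 2 * (1 - sin (t / 2) ^+ 2)).
  have {1}-> : t = (t / 2) *+ 2 by rewrite -mulr_natr divfK.
  by rewrite sin_mulr2n -mulr_natl -cos2sin2; ring.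
by apply/eqP; ring.
Qed.

Lemma sin_mvt x : 0 <= x -> exists2 y, 0 <= y <= x & sin x = x * cos y.
Proof.
move=> x0.
have [|y] := @MVT_segment K sin cos 0 x x0 (fun y _ => is_derive_sin y).
  by apply: continuous_subspaceT => y; exact: continuous_sin.
rewrite in_itv/= sin0 !subr0 mulrC => y0x ->.
by exists y.
Qed.

(** A weak Jordan inequality. Up to 1 the cosine is at least [1 / 2]; beyond 1,
    [sin x >= sin 1 >= 1 / 2], while [x / 4] stays below [1 / 2]. *)
Lemma sin_ge_quarter x : 0 <= x <= pi / 2 -> x / 4 <= sin x.
Proof.
move=> /andP[x0 xpi].
have sin_le (y : K) : 0 <= y -> sin y <= y.
  by move=> y0; have [z _ ->] := sin_mvt y0; rewrite ler_piMr ?cos_le1.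
have sin_ge (y : K) : 0 <= y <= 1 -> y / 2 <= sin y.
  move=> /andP[y0 y1]; have [z /andP[z0 zy] ->] := sin_mvt y0.
  rewrite ler_wpM2l//.
  have -> : z = (z / 2) *+ 2 by rewrite -mulr_natr divfK.
  have -> : cos (z / 2 *+ 2) = 1 - 2 * (sin (z / 2) * sin (z / 2)).
    by rewrite cos_mulr2n cos2sin2; ring.
  have s0 : 0 <= sin (z / 2).
    by apply: sin_ge0_pi; have := pi_ge2 K; lra.
  have := sin_le (z / 2).
  have : sin (z / 2) * sin (z / 2) <= sin (z / 2).
    by rewrite ler_piMr// sin_le1.
  have h := @ler_pM _ (sin (z/2)) (z / 2) (sin (z/2)) (z/2) s0 s0.
  move=> _ h2; have {}h2 : sin (z / 2) <= z / 2 by apply: h2; lra.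
  have {}h := h h2 h2; have : z / 2 * (z / 2) <= 2^-1 * 2^-1.
    by rewrite ler_pM//; lra.
  by lra.
have [x1|x1] := leP x 1.
  by have := sin_ge x; rewrite x0 x1 => /(_ isT); lra.
have s1 : 1 / 2 <= sin 1 :> K by apply: sin_ge; rewrite ler01 lexx.
have : sin 1 <= sin x :> K.
  have p2 := pihalf_ge1 K.
  by apply: ltW; rewrite ltr_sin// in_itv/=; lra.
by have := pihalf_lt2 K; lra.
Qed.

(** The left side is the distance of [s / N] to the nearest integer; the reflection
    [sin (pi - x) = sin x] reduces to [s <= N / 2]. *)
Lemma normc_cis1_ge (N s : nat) : (0 < N)%N -> (s <= N)%N ->
  (minn s (N - s))%:R / N%:R <= normc (cis (2 * pi * (s%:R / N%:R)) - 1).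
Proof.
move=> N0 sN.
have N0' : 0 < N%:R :> K by rewrite ltr0n.
have pi2 := pi_ge2 K.
rewrite normc_cis1 (_ : 2 * pi * (s%:R / N%:R) / 2 = pi * (s%:R / N%:R)); last first.
  by field; rewrite gt_eqF.
have key (a : nat) : (a.*2 <= N)%N -> a%:R / N%:R <= 2 * sin (pi * (a%:R / N%:R)) :> K.
  move=> aN; set b : K := a%:R / N%:R.
  have b0 : 0 <= b by rewrite /b; nonneg.
  have b2 : b <= 2^-1.
    rewrite /b ler_pdivrMr//; have : (a.*2%:R <= N%:R :> K) by rewrite ler_nat.
    by rewrite -muln2 natrM; lra.
  have : pi * b / 4 <= sin (pi * b).
    apply: sin_ge_quarter; apply/andP; split; first by rewrite mulr_ge0//; lra.
    by rewrite ler_wpM2l//; lra.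
  have : 2 * b <= pi * b by rewrite ler_wpM2r.
  by lra.
have [h|h] := leqP s.*2 N.
  rewrite (minn_idPl _); last by rewrite leq_subRL// addnn.
  apply: (le_trans (key s h)); rewrite ler_wpM2l//; exact: ler_norm.
rewrite (minn_idPr _); last by rewrite leq_subLR addnn ltnW.
have sN2 : ((N - s).*2 <= N)%N.
  by rewrite doubleB leq_subLR -[s.*2]addnn -addnn; lia.
apply: (le_trans (key _ sN2)); rewrite ler_wpM2l//.
rewrite natrB// mulrBl divff ?gt_eqF// mulrBr mulr1.
have -> : sin (pi - pi * (s%:R / N%:R)) = sin (pi * (s%:R / N%:R)) :> K.
  by rewrite addrC sinDpi sinN opprK.
exact: ler_norm.
Qed.

Variable N : nat.
Hypothesis N0 : (0 < N)%N.
Let z := cis (2 * pi / N%:R).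

Lemma root_N : z ^+ N = 1.
Proof.
by rewrite /z -cisMn divfK ?cis_2pi// pnatr_eq0 -lt0n.
Qed.

Lemma root_cis s : z ^+ s = cis (2 * pi * (s%:R / N%:R)).
Proof. by rewrite /z -cisMn mulrAC mulrA. Qed.

Lemma root_neq1 s : (0 < s < N)%N -> z ^+ s != 1.
Proof.
move=> /andP[s0 sN]; rewrite -subr_eq0 -normc_gt0 root_cis.
rewrite (lt_le_trans _ (normc_cis1_ge N0 (ltnW sN)))//.
by rewrite divr_gt0 ?ltr0n// leq_min s0 subn_gt0.
Qed.

Lemma sum_roots (w : K[i]) : w ^+ N = 1 -> w != 1 -> \sum_(s < N) w ^+ s = 0.
Proof.
move=> wN w1; have := subrX1 w N; rewrite wN subrr => /esym/eqP.
by rewrite mulf_eq0 subr_eq0 (negbTE w1)/= => /eqP.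
Qed.

(** The exponent [N - k + j] represents [j - k] modulo [N] without negative powers. *)
Definition dft_coef (k j : nat) : K[i] :=
  N%:R^-1 * \sum_(s < N) (z ^+ (N - k + j)) ^+ s.

Lemma dft_coef_eq k : (k < N)%N -> dft_coef k k = 1.
Proof.
move=> kN; rewrite /dft_coef subnK ?(ltnW kN)// root_N.
under eq_bigr do rewrite expr1n.
by rewrite sumr_const card_ord mulVf// pnatr_eq0 -lt0n.
Qed.

Lemma dft_coef_neq k j : (k < N)%N -> (j < N)%N -> j != k -> dft_coef k j = 0.
Proof.
move=> kN jN jk; rewrite /dft_coef sum_roots ?mulr0//.
  by rewrite exprAC root_N expr1n.
have [kj|kj] := ltnP k j; last first.
  by apply: root_neq1; move/eqP: jk => jk; lia.
have -> : (N - k + j = N + (j - k))%N by lia.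
by rewrite exprD root_N mul1r; apply: root_neq1; lia.
Qed.

Lemma normc_root s : normc (z ^+ s) = 1.
Proof. by rewrite normcX normc_cis expr1n. Qed.

Lemma normc_dft_coef k j : normc (dft_coef k j) <= 1.
Proof.
rewrite /dft_coef Normc.normcM normc_natV ler_pdivrMl ?ltr0n// mulr1.
rewrite (le_trans (normc_sum_le _ _ _))//.
under eq_bigr do rewrite normcX normc_root expr1n.
by rewrite sumr_const card_ord.
Qed.

(* Averaging against the [N]-th roots of unity keeps only the indices equal to
   [k] modulo [N]; those other than [k] are at least [N]. *)
Lemma dft_bound (u : nat -> K) (k J : nat) : (k < N)%N -> (N <= J)%N ->
  `|u k| <= N%:R^-1 * \sum_(s < N)
     normc (\sum_(0 <= j < J) cis (2 * pi * (s%:R / N%:R) * j%:R) * (u j)%:C)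
    + \sum_(N <= j < J) `|u j|.
Proof.
move=> kN NJ.
pose S (s : nat) := \sum_(0 <= j < J) cis (2 * pi * (s%:R / N%:R) * j%:R) * (u j)%:C.
have e1 : N%:R^-1 * \sum_(s < N) (z ^+ (N - k)) ^+ s * S s =
    \sum_(0 <= j < J) dft_coef k j * (u j)%:C.
  under eq_bigr do rewrite mulr_sumr.
  rewrite exchange_big/= mulr_sumr; apply: eq_bigr => j _.
  rewrite /dft_coef -mulrA mulr_suml; congr (_ * _); apply: eq_bigr => s _.
  rewrite cisMn -root_cis mulrA; congr (_ * _).
  by rewrite exprD [RHS]exprMn; congr (_ * _); exact: exprAC.
have e2 : \sum_(0 <= j < J) dft_coef k j * (u j)%:C =
    (u k)%:C + \sum_(N <= j < J) dft_coef k j * (u j)%:C.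
  rewrite (big_cat_nat (leq0n N) NJ)/=; congr (_ + _).
  rewrite big_mkord (bigD1 (Ordinal kN))//= dft_coef_eq// mul1r big1 ?addr0//.
  move=> j jk; rewrite dft_coef_neq ?mul0r//.
rewrite -normc_real.
have -> : (u k)%:C = N%:R^-1 * \sum_(s < N) (z ^+ (N - k)) ^+ s * S s
    - \sum_(N <= j < J) dft_coef k j * (u j)%:C by rewrite e1 e2 addrK.
rewrite (le_trans (normcB_le _ _))// lerD//.
  rewrite Normc.normcM normc_natV ler_wpM2l ?invr_ge0//.
  rewrite (le_trans (normc_sum_le _ _ _))//; apply: ler_sum => s _.
  by rewrite Normc.normcM normcX normc_root expr1n mul1r.
rewrite (le_trans (normc_sum_le _ _ _))//; apply: ler_sum => j _.
by rewrite Normc.normcM normc_real ler_piMl// normc_dft_coef.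
Qed.

End RootsOfUnity.

(** * From a pointwise bound on the transform to a uniform bound on the sequence *)

Section FourierBound.
Variable K : realType.

(* Each term is at most the increment of [2 * s / (1 + a * s)]. *)
Lemma sum_cauchy_kernel (a : K) (S : nat) : 0 < a ->
  \sum_(1 <= s < S.+1) (1 + (a * s%:R) ^+ 2)^-1 <= 2 / a.
Proof.
move=> a0.
suff h : \sum_(1 <= s < S.+1) (1 + (a * s%:R) ^+ 2)^-1 <= 2 * S%:R / (1 + a * S%:R).
  apply: (le_trans h); rewrite ler_pdivrMr; last by rewrite ltr_wpDr; nonneg.
  rewrite mulrAC ler_pdivlMr// mulrDr mulr1.
  by lra.
elim: S => [|S IH]; first by rewrite big_nil mulr0 mul0r.
rewrite big_nat_recr//= (le_trans (lerD IH (lexx _)))//.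
set s : K := S%:R; have s0 : 0 <= s by rewrite /s.
rewrite (_ : S.+1%:R = s + 1); last by rewrite /s natr1.
have h1 : 0 < 1 + a * s by rewrite ltr_wpDr//; nonneg.
have h2 : 0 < 1 + a * (s + 1) by rewrite ltr_wpDr//; nonneg.
have h3 : 0 < 1 + (a * (s + 1)) ^+ 2 by rewrite ltr_wpDr// sqr_ge0.
rewrite -lerBrDl.
have -> : 2 * (s + 1) / (1 + a * (s + 1)) - 2 * s / (1 + a * s) =
    2 / ((1 + a * (s + 1)) * (1 + a * s)).
  by field; rewrite !gt_eqF.
rewrite ler_pdivlMr ?mulr_gt0// mulrC ler_pdivrMr//.
have : 0 <= a * s by nonneg.
have := sqr_ge0 (a * (s + 1) - 1).
by nra.
Qed.

(** For fixed [eps], [N] is taken so large that the aliasing tail and the contribution [alpha / N]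
    of the root 1 are each at most [eps / 3]. The constant 4 is the 2 of [sum_cauchy_kernel],
    counted for both half circles. *)
Lemma fourier_sup_le (u : nat -> K) (F : K -> K[i]) (sigma alpha beta : K) :
  0 < sigma -> 0 <= alpha ->
  (forall eps : K, 0 < eps -> exists N, forall J,
     \sum_(N <= j < J) `|u j| <= eps) ->
  (forall t eps : K, 0 < eps -> exists J0, forall J, (J0 <= J)%N ->
     normc (\sum_(0 <= j < J) cis (t * j%:R) * (u j)%:C - F t) <= eps) ->
  (forall t, normc (F t) <=
     alpha / (1 + (sigma * normc (cis t - 1)) ^+ 2) + beta) ->
  forall k, `|u k| <= 4 * (alpha / sigma) + beta.
Proof.
move=> s0 a0 tail cvF boundF k.
apply/ler_addgt0Pr => eps eps0.
have e3 : 0 < eps / 3 by lra.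
have [N1 tail1] := tail _ e3.
pose N := (maxn N1 (maxn k (Num.bound (alpha / (eps / 3))))).+1.
have N1N : (N1 <= N)%N by rewrite /N; lia.
have kN : (k < N)%N by rewrite /N; lia.
have N0 : (0 < N)%N by [].
have N0' : 0 < N%:R :> K by rewrite ltr0n.
have aN : alpha / N%:R <= eps / 3.
  rewrite ler_pdivrMr// mulrC -ler_pdivrMr// ltW//.
  rewrite (lt_le_trans (archi_boundP _))//; first by rewrite divr_ge0// ltW.
  by rewrite ler_nat /N leqW// !leq_max leqnn !orbT.
pose t s : K := 2 * pi * (s%:R / N%:R).
(* Convergence is only pointwise in [t], but finitely many sample points admit a common [J0]. *)
have unif (M : nat) : exists J0, forall s, (s < M)%N -> forall J, (J0 <= J)%N ->
    normc (\sum_(0 <= j < J) cis (t s * j%:R) * (u j)%:C - F (t s)) <= eps / 3.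
  elim: M => [|M [J1 J1P]]; first by exists 0%N.
  have [J2 J2P] := cvF (t M) _ e3.
  exists (maxn J1 J2) => s; rewrite ltnS leq_eqVlt => /orP[/eqP->|sM] J;
    rewrite geq_max => /andP[h1 h2]; [exact: J2P|exact: J1P].
have [J0 J0P] := unif N.
pose J := maxn J0 N.
have NJ : (N <= J)%N by rewrite leq_maxr.
apply: (le_trans (dft_bound N0 u kN NJ)).
have tN : \sum_(N <= j < J) `|u j| <= eps / 3.
  apply: le_trans (tail1 J); rewrite [leRHS](big_cat_nat N1N (leq_maxr J0 N))/=.
  by rewrite lerDr sumr_ge0.
suff : N%:R^-1 * \sum_(s < N) normc (\sum_(0 <= j < J) cis (t s * j%:R) * (u j)%:C)
    <= 4 * (alpha / sigma) + beta + 2 * (eps / 3).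
  by rewrite -/(t _); lra.
pose g (s : nat) : K := (1 + (sigma / N%:R * s%:R) ^+ 2)^-1.
have g0 s : 0 <= g s by rewrite /g invr_ge0 addr_ge0 ?sqr_ge0.
have step (s : 'I_N) : normc (\sum_(0 <= j < J) cis (t s * j%:R) * (u j)%:C)
    <= alpha * (g s + g (N - s)%N) + beta + eps / 3.
  have := J0P s (ltn_ord s) J (leq_maxl _ _).
  set Sm := \sum_(0 <= j < J) _ => h.
  have -> : Sm = (Sm - F (t s)) + F (t s) by rewrite subrK.
  rewrite (le_trans (normcD_le _ _))// addrC lerD// (le_trans (boundF _))//.
  rewrite lerD2r ler_wpM2l//.
  have hmin := normc_cis1_ge K N0 (ltnW (ltn_ord s)).
  apply: (@le_trans _ _ (g (minn s (N - s)))).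
    rewrite /g lef_pV2 ?posrE ?ltr_wpDr ?sqr_ge0// lerD2l.
    rewrite lerXn2r ?nnegrE; [by []|by nonneg|by nonneg|].
    by rewrite -mulrA ler_pM2l// mulrC.
  by case: (leqP s (N - s)) => _; rewrite ?lerDl ?lerDr.
have gsum : \sum_(s < N) (g s + g (N - s)%N) <= 1 + 4 * (N%:R / sigma).
  have aa : 0 < sigma / N%:R by rewrite divr_gt0.
  have h := sum_cauchy_kernel N aa.
  rewrite big_split/=.
  have r2 : \sum_(s < N) g (N - s)%N = \sum_(1 <= s < N.+1) g s.
    by rewrite -(big_mkord xpredT (fun s => g (N - s)%N)) big_nat_rev/= big_add1/=
      big_nat [RHS]big_nat; apply: eq_bigr => i /andP[_ iN]; congr g; lia.
  have r1 : \sum_(s < N) g s <= 1 + \sum_(1 <= s < N.+1) g s.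
    rewrite -(big_mkord xpredT g) (@le_trans _ _ (\sum_(0 <= s < N.+1) g s))//.
      by rewrite [leRHS]big_nat_recr//= lerDl.
    rewrite big_ltn// lerD2r /g mulr0 expr0n addr0 invr1//.
  have dV : 2 / (sigma / N%:R) = 2 * (N%:R / sigma) by rewrite invf_div.
  by move: h; rewrite dV r2 -/g; lra.
apply: (@le_trans _ _ (N%:R^-1 * \sum_(s < N)
    (alpha * (g s + g (N - s)%N) + (beta + eps / 3)))).
  rewrite ler_wpM2l ?invr_ge0//; apply: ler_sum => s _; rewrite addrA; exact: step.
rewrite big_split/= sumr_const card_ord -[X in _ * (_ + X)]mulr_natl.
rewrite mulrDr mulKf ?gt_eqF//.
rewrite -mulr_sumr.
have : N%:R^-1 * (alpha * \sum_(s < N) (g s + g (N - s)%N)) <=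
    N%:R^-1 * (alpha * (1 + 4 * (N%:R / sigma))).
  by rewrite ler_wpM2l ?invr_ge0// ler_wpM2l.
have -> : N%:R^-1 * (alpha * (1 + 4 * (N%:R / sigma))) =
    alpha / N%:R + 4 * (alpha / sigma) by field; rewrite !gt_eqF.
lra.
Qed.

End FourierBound.

(** * Law of the waiting time *)

Section CountingDraws.
Variable n : nat.
Implicit Types (s : seq 'I_n) (Q : pred (seq 'I_n)).

Fixpoint words (t : nat) : seq (seq 'I_n) :=
  if t is t'.+1 then [seq rcons s x | s <- words t', x <- enum 'I_n]
  else [:: [::]].

Lemma mem_words t s : (s \in words t) = (size s == t).
Proof.
elim: t s => [|t IH] s /=; first by rewrite inE size_eq0.
apply/allpairsP/idP => [[[s' x]/= [h _ ->]]|].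
  by rewrite size_rcons eqSS -IH.
case/lastP: s => // s x; rewrite size_rcons eqSS -IH => h.
by exists (s, x); rewrite mem_enum.
Qed.

Lemma words_uniq t : uniq (words t).
Proof.
elim: t => //= t IH; apply: allpairs_uniq => //; first exact: enum_uniq.
by move=> [s x] [s' x'] _ _ /= /rcons_inj[-> ->].
Qed.

Lemma count_words Q t :
  count Q (words t.+1) = (\sum_(s <- words t) #|[pred x | Q (rcons s x)]|)%N.
Proof.
rewrite /= count_flatten sumnE !big_map; apply: eq_bigr => s _.
rewrite count_map cardE -size_filter; congr size.
by rewrite /enum_mem -filter_predI; apply: eq_filter => x; rewrite /= !inE andbT.
Qed.

Lemma size_undup_card s : size (undup s) = #|s|.
Proof.
by rewrite -(card_uniqP (undup_uniq s)); apply: eq_card => y; rewrite mem_undup.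
Qed.

Lemma size_undup_rcons s (x : 'I_n) :
  size (undup (rcons s x)) = ((x \notin s) + size (undup s))%N.
Proof.
have cE (r : seq 'I_n) : size (undup r) = #|[set y in r]| by rewrite cardsE size_undup_card.
rewrite !cE (_ : [set y in rcons s x] = x |: [set y in s])%SET; last first.
  by apply/setP => y; rewrite !inE mem_rcons inE.
by rewrite cardsU1 inE.
Qed.

Lemma card_notin_word s : #|[pred x : 'I_n | x \notin s]| = (n - size (undup s))%N.
Proof.
have := cardC (mem s); rewrite card_ord.
rewrite -size_undup_card.
move=> h; have -> : (n - size (undup s))%N = #|[predC mem s]| by rewrite -[X in (X - _)%N]h addKn.
by apply: eq_card => y; rewrite !inE.
Qed.

Lemma card_in_word s : #|[pred x : 'I_n | x \in s]| = size (undup s).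
Proof.
by rewrite size_undup_card; apply: eq_card.
Qed.

Lemma size_undup_words t s : s \in words t -> (size (undup s) <= t)%N.
Proof. by rewrite mem_words => /eqP <-; exact: size_undup. Qed.

Definition distinct_count (t j : nat) : nat :=
  count (fun s => size (undup s) == j) (words t).

Lemma distinct_count_gt t j : (t < j)%N -> distinct_count t j = 0%N.
Proof.
move=> tj; apply/eqP; rewrite -leqn0 leqNgt -has_count; apply/hasPn => s.
by move=> /size_undup_words h; rewrite neq_ltn (leq_ltn_trans h).
Qed.

Lemma distinct_countS0 t : distinct_count t.+1 0 = 0%N.
Proof.
apply/eqP; rewrite -leqn0 leqNgt -has_count; apply/hasPn => s.
rewrite mem_words; case/lastP: s => // s x _.
rewrite size_undup_rcons; case: (boolP (x \in s)) => //= xs.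
by rewrite add0n size_eq0; apply: contraTneq xs => h; rewrite -mem_undup h.
Qed.

Lemma sum_distinct t j (c : nat) :
  (\sum_(s <- words t) (size (undup s) == j) * c = distinct_count t j * c)%N.
Proof.
rewrite /distinct_count -sum1_count big_distrl [RHS]big_mkcond/=.
by apply: eq_bigr => s _; case: eqP.
Qed.

(** The last letter is one of the [j.+1] already present or one of the [n - j] absent ones: the
    recurrence of Stirling numbers of the second kind, weighted by falling factorials. *)
Lemma distinct_countS t j : distinct_count t.+1 j.+1 =
  (distinct_count t j.+1 * j.+1 + distinct_count t j * (n - j))%N.
Proof.
rewrite /distinct_count count_words -2!sum_distinct -big_split/=.
apply: eq_bigr => s _; set k := size (undup s).
rewrite (eq_card (B := [pred x | if x \in s then k == j.+1 else k == j])); last first.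
  by move=> x; rewrite !inE size_undup_rcons -/k; case: (x \in s).
have [kj|kj] := eqVneq k j.+1.
  have -> : (k == j) = false by rewrite kj; elim: (j).
  rewrite mul1n mul0n addn0 -kj /k -card_in_word; apply: eq_card => x.
  by rewrite !inE; case: ifP.
rewrite mul0n add0n; have [<-|kj'] := eqVneq k j.
  by rewrite mul1n /k -card_notin_word; apply: eq_card => x; rewrite !inE; case: ifP.
by rewrite mul0n; apply: eq_card0 => x; rewrite !inE; case: ifP.
Qed.

Definition first_hit (M : nat) (s : seq 'I_n) : bool :=
  (M <= size (undup s))%N && (size (undup (take (size s).-1 s)) < M)%N.

Lemma count_first_hit t M : (M < n)%N ->
  count (first_hit M.+1) (words t.+1) = (distinct_count t M * (n - M))%N.
Proof.
move=> Mn; rewrite count_words -sum_distinct; apply: eq_bigr => s _.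
have first_hitE x : first_hit M.+1 (rcons s x) =
    (size (undup s) == M) && (x \notin s).
  rewrite /first_hit size_rcons/= -cats1 take_size_cat// cats1.
  rewrite size_undup_rcons; case: (x \in s) => /=.
    by rewrite add0n andbF; apply/negP => /andP[h]; rewrite ltnNge h.
  by rewrite add1n !ltnS -eqn_leq eq_sym andbT.
rewrite (eq_card (B := [pred x | (size (undup s) == M) && (x \notin s)])); last first.
  by move=> x; rewrite !inE first_hitE.
have [<-|sM] := eqVneq (size (undup s)) M.
  by rewrite mul1n -card_notin_word; apply: eq_card => x; rewrite !inE.
by rewrite mul0n; apply: eq_card0.
Qed.

End CountingDraws.

Section HitProbability.
Variables (K : realType) (n : nat).
Hypothesis n0 : (0 < n)%N.

(* Probability that exactly [j] distinct coupons are seen in [i + j] draws. *)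
Definition hit_prob (j i : nat) : K :=
  (distinct_count n (i + j) j)%:R / n%:R ^+ (i + j).

Lemma hit_prob00 : hit_prob 0 0 = 1.
Proof. by rewrite /hit_prob /distinct_count/= expr0 divr1. Qed.

Lemma hit_prob0S i : hit_prob 0 i.+1 = 0.
Proof. by rewrite /hit_prob addn0 distinct_countS0 mul0r. Qed.

Lemma hit_probS0 j : (j <= n)%N ->
  hit_prob j.+1 0 = hit_prob j 0 * ((n%:R - j%:R) / n%:R).
Proof.
move=> jn; rewrite /hit_prob !add0n distinct_countS distinct_count_gt// mul0n add0n.
have nn : (n%:R : K) != 0 by rewrite pnatr_eq0 -lt0n.
by rewrite natrM natrB// exprS; field; rewrite expf_neq0 ?nn.
Qed.

(** Counting by the number [i] of repeated draws makes this a first-order recurrence of ratio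
    [j.+1 / n], the form required by [has_cf_geometric]. *)
Lemma hit_probSS j i : (j <= n)%N ->
  hit_prob j.+1 i.+1 = hit_prob j.+1 i * (j.+1%:R / n%:R)
    + hit_prob j i.+1 * ((n%:R - j%:R) / n%:R).
Proof.
move=> jn; rewrite /hit_prob.
have -> : (i.+1 + j.+1 = (i + j.+1).+1)%N by [].
rewrite distinct_countS addSnnS.
have nn : (n%:R : K) != 0 by rewrite pnatr_eq0 -lt0n.
by rewrite natrD !natrM natrB// exprS; field; rewrite expf_neq0 ?nn.
Qed.

End HitProbability.

(** * From the probability space to counts of words *)

Section WaitingLaw.
Variables (K : realType) (d : measure_display) (T : measurableType d).
Variables (P : probability T K) (n : nat) (D : nat -> T -> 'I_n).
Hypothesis DP : coupon_draws P D.

Local Notation draws t w := [seq D i w | i <- iota 0 t].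

Lemma draws_eqE t (c0 : 'I_n) (s : seq 'I_n) : size s = t ->
  [set w | draws t w = s] =
  \bigcap_(i in [set` iota 0 t]) (D i @^-1` [set nth c0 s i]).
Proof.
move=> st; apply/seteqP; split=> w /=.
  move=> sE i /=; rewrite mem_iota add0n => /= it.
  by rewrite -sE (nth_map 0%N) ?size_iota// nth_iota.
move=> h; apply: (@eq_from_nth _ c0); rewrite size_map size_iota ?st// => i it.
by rewrite (nth_map 0%N) ?size_iota// nth_iota// add0n h//= mem_iota.
Qed.

Lemma measurable_draws_eq t (s : seq 'I_n) : measurable [set w | draws t w = s].
Proof.
have [mD _ _] := DP.
have [st|st] := eqVneq (size s) t; last first.
  rewrite (_ : [set _ | _] = set0)//; apply/seteqP; split=> // w/= sE.
  by move: st; rewrite -sE size_map size_iota eqxx.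
(* The empty word is treated apart: it yields no element of ['I_n] to serve as default for [nth]. *)
case: t st => [|t] st.
  by case: s st => // _; rewrite (_ : [set _ | _] = setT)//; apply/seteqP; split.
have c0 : 'I_n by case: s st => [|x].
rewrite (draws_eqE c0)//; apply: bigcap_measurable => //.
by exists 0%N; rewrite /= inE eqxx.
Qed.

Lemma prob_draws_eq t (s : seq 'I_n) : size s = t ->
  P [set w | draws t w = s] = ((n%:R ^+ t)^-1)%:E.
Proof.
have [_ pD iD] := DP; case: t => [|t] st.
  case: s st => // _; rewrite expr0 invr1 (_ : [set _ | _] = setT).
    exact: probability_setT.
  by apply/seteqP; split.
have c0 : 'I_n by case: s st => [|x].
rewrite (draws_eqE c0)// (iD (iota 0 t.+1) (fun i => [set nth c0 s i])) ?iota_uniq//.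
rewrite (eq_bigr (fun=> (n%:R^-1)%:E)) => [|i _]; last exact: pD.
rewrite prodEFin; congr (_%:E).
by rewrite big_const_seq count_predT size_iota iter_mulr_1 exprVn.
Qed.

Lemma prob_draws_mem t (L : seq (seq 'I_n)) : uniq L ->
  (forall s, s \in L -> size s = t) ->
  measurable [set w | draws t w \in L] /\
  P [set w | draws t w \in L] = ((size L)%:R / n%:R ^+ t)%:E.
Proof.
elim: L => [|s L IH] /=.
  rewrite (_ : [set _ | _] = set0); last by apply/seteqP; split.
  by rewrite measure0 mul0r.
move=> /andP[sL uL] Lt.
have [mL pL] := IH uL (fun s' h => Lt s' (mem_behead (s := s :: L) h)).
have -> : [set w | draws t w \in s :: L] =
    [set w | draws t w = s] `|` [set w | draws t w \in L].
  apply/seteqP; split=> w /=; rewrite inE; first by move=> /orP[/eqP|]; [left|right].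
  by move=> [->|->]; rewrite ?eqxx ?orbT.
have ms := measurable_draws_eq t s.
split; first exact: measurableU.
rewrite measureU//; last first.
  apply/seteqP; split=> // w /= [-> h]; by rewrite h in sL.
have ps := prob_draws_eq (Lt s (mem_head _ _)).
transitivity (((n%:R ^+ t)^-1)%:E + ((size L)%:R / n%:R ^+ t)%:E : \bar K)%E.
  by congr (_ + _)%E.
by rewrite -EFinD; congr (_%:E); rewrite -[(size L).+1%:R]natr1 mulrDl mul1r addrC.
Qed.

Lemma prob_draws t (Q : pred (seq 'I_n)) :
  P [set w | Q (draws t w)] = ((count Q (words n t))%:R / n%:R ^+ t)%:E.
Proof.
have [||_] := @prob_draws_mem t [seq s <- words n t | Q s].
- by rewrite filter_uniq ?words_uniq.
- by move=> s; rewrite mem_filter mem_words => /andP[_ /eqP].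
- rewrite size_filter => <-; congr (P _); apply/seteqP; split=> w /=;
    by rewrite mem_filter mem_words size_map size_iota eqxx andbT.
Qed.

Lemma distinct_couponsS t w :
  (distinct_coupons D t w <= distinct_coupons D t.+1 w <= (distinct_coupons D t w).+1)%N.
Proof.
rewrite /distinct_coupons -addn1 iotaD/= map_cat/= cats1 size_undup_rcons.
by case: (_ \notin _); rewrite ?add0n ?add1n ?leqnn ?leqnSn.
Qed.

Lemma distinct_coupons_mono t t' w : (t <= t')%N ->
  (distinct_coupons D t w <= distinct_coupons D t' w)%N.
Proof.
move=> /subnK <-; elim: (t' - t)%N => // k; rewrite addSn => h.
by apply: (leq_trans h); have /andP[] := distinct_couponsS (k + t) w.
Qed.

Lemma distinct_coupons_le t w : (distinct_coupons D t w <= t)%N.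
Proof. by rewrite (leq_trans (size_undup _))// size_map size_iota. Qed.

Lemma waiting_time_min (m : nat) w (t : nat) :
  (n - m <= distinct_coupons D t w)%N ->
  (forall t', (t' < t)%N -> (distinct_coupons D t' w < n - m)%N) ->
  waiting_time K D m w = (t%:R)%:E.
Proof.
move=> h1 h2; apply/eqP; rewrite eq_le; apply/andP; split.
  by apply: ereal_inf_lbound; exists t.
apply/ereal_infP => _ [t' /= h <-]; rewrite lee_fin ler_nat leqNgt.
by apply/negP => /h2; rewrite ltnNge h.
Qed.

Lemma waiting_time_cases (m : nat) w :
  waiting_time K D m w = +oo%E \/
  exists t : nat, [/\ (n - m <= distinct_coupons D t w)%N,
    forall t', (t' < t)%N -> (distinct_coupons D t' w < n - m)%N
    & waiting_time K D m w = (t%:R)%:E].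
Proof.
have [ex|nex] := pselect (exists t, (n - m <= distinct_coupons D t w)%N).
  right; case: (ex_minnP ex) => t h hmin; exists t.
  have hlt t' : (t' < t)%N -> (distinct_coupons D t' w < n - m)%N.
    by move=> t't; rewrite ltnNge; apply/negP => /hmin; rewrite leqNgt t't.
  by split=> //; exact: waiting_time_min.
left; rewrite /waiting_time (_ : [set _ | _ in _] = set0) ?ereal_inf0//.
by apply/seteqP; split=> // _ [t /= h _]; apply: nex; exists t.
Qed.

Lemma waiting_timeP (m : nat) w (t : nat) :
  (waiting_time K D m w = (t%:R)%:E) <->
  ((n - m <= distinct_coupons D t w)%N /\
   forall t', (t' < t)%N -> (distinct_coupons D t' w < n - m)%N).
Proof.
split=> [WE|[h1 h2]]; last exact: waiting_time_min.
have [|[t0 [h1 h2]]] := waiting_time_cases m w; rewrite WE// => /eqP.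
by rewrite eqe eqr_nat => /eqP ->.
Qed.

Variable m : nat.
Hypotheses (m1 : (0 < m)%N) (mn : (m < n)%N).

(** The draw that completes the collection is new: [n - m - 1] coupons have been seen before it, so
    [m.+1] choices remain. *)
Lemma waiting_time_law (t : nat) :
  P [set w | waiting_time K D m w = (t.+1%:R)%:E] =
  ((distinct_count n t (n - m).-1)%:R * m.+1%:R / n%:R ^+ t.+1)%:E.
Proof.
have nm : (n - m = (n - m).-1.+1)%N by rewrite prednK// subn_gt0.
have hitE w : first_hit (n - m) (draws t.+1 w) =
    (n - m <= distinct_coupons D t.+1 w)%N && (distinct_coupons D t w < n - m)%N.
  rewrite /first_hit size_map size_iota -pred_Sn.
  by rewrite -map_take take_iota (minn_idPl (leqnSn t)).
have -> : [set w | waiting_time K D m w = (t.+1%:R)%:E] =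
    [set w | first_hit (n - m) (draws t.+1 w)].
  apply: eq_set => w; rewrite hitE; apply/propext; split.
    by move/waiting_timeP => [-> h2]; exact: h2.
  move=> /andP[h1 h2]; apply/waiting_timeP; split=> // t' tt'.
  by apply: leq_ltn_trans h2; exact: distinct_coupons_mono.
rewrite prob_draws nm count_first_hit; last by rewrite prednK ?subn_gt0//; lia.
by rewrite natrM; congr ((_ * _%:R * _)%:E); lia.
Qed.

Lemma waiting_time_ge w (t : nat) : waiting_time K D m w = (t%:R)%:E -> (n - m <= t)%N.
Proof.
by move/waiting_timeP => [h _]; apply: (leq_trans h); exact: distinct_coupons_le.
Qed.

(** [k - c] is the number of repeated draws, which cannot be negative since [n - m] coupons take at
    least [n - m] draws. The final factor is the chance that the completing draw is new. *)
Lemma coupon_muE (k : int) : coupon_mu P D m k =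
  (if k - coupon_c K n m is Posz i
   then hit_prob K n (n - m).-1 i * (m.+1%:R / n%:R) else 0)%:E.
Proof.
rewrite /coupon_mu.
have shiftE w : shifted_waiting_time K D m w = (k%:~R)%:E <->
    waiting_time K D m w = ((k - coupon_c K n m + (n - m)%N%:Z)%:~R)%:E.
  rewrite /shifted_waiting_time; case: (waiting_time K D m w) => [r||]//=.
  rewrite -!EFinD rmorphD rmorphB/=.
  by split=> -[h]; congr (_%:E); move: h; rewrite -pmulrn; lra.
have -> : shifted_waiting_time K D m @^-1` [set (k%:~R)%:E] =
    [set w | waiting_time K D m w = ((k - coupon_c K n m + (n - m)%N%:Z)%:~R)%:E].
  by apply/seteqP; split=> w /= /shiftE.
case: (k - coupon_c K n m) => i.
  have iE : (i + (n - m) = (i + (n - m).-1).+1)%N by lia.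
  have -> : (i%:Z + (n - m)%N%:Z)%:~R = ((i + (n - m).-1).+1%:R : K).
    by rewrite -PoszD -pmulrn iE.
  rewrite waiting_time_law; congr (_%:E); rewrite /hit_prob exprS.
  have nn : (n%:R : K) != 0 by rewrite pnatr_eq0; lia.
  by field; rewrite expf_neq0 ?nn.
rewrite (_ : [set _ | _] = set0) ?measure0//; apply/seteqP; split=> // w /=.
set x := _%:E => WE.
have [|[N [_ _]]] := waiting_time_cases m w; rewrite WE// => xE.
have := waiting_time_ge (etrans WE xE).
move: xE; rewrite /x => -[]/eqP; rewrite (pmulrn _ N) eqr_int => /eqP.
by lia.
Qed.

End WaitingLaw.

(** * Characteristic functions of sequences *)

Section GeneratingFunctions.
Variable K : realType.
Implicit Types (u v : nat -> K) (F : K -> K[i]).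

Definition bounded_sums u := exists A : K, forall J, \sum_(0 <= j < J) `|u j| <= A.

Definition has_cf u F := forall t eps : K, 0 < eps -> exists J0, forall J, (J0 <= J)%N ->
  normc (\sum_(0 <= j < J) cis (t * j%:R) * (u j)%:C - F t) <= eps.

Lemma bounded_sums_tail u : bounded_sums u ->
  forall eps : K, 0 < eps -> exists N, forall J, \sum_(N <= j < J) `|u j| <= eps.
Proof.
move=> [A uA] eps eps0.
pose S : set K := range (fun J => \sum_(0 <= j < J) `|u j|).
have supS : has_sup S.
  split; first by exists (\sum_(0 <= j < 0) `|u j|); exists 0%N.
  by exists A => _ [J _ <-]; exact: uA.
have [_ [N _ <-] hN] := sup_adherent eps0 supS.
exists N => J; have [JN|NJ] := leqP J N.
  by rewrite big_geq// ltW.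
have : \sum_(0 <= j < J) `|u j| <= sup S.
  by apply: ub_le_sup; [case: supS|exists J].
rewrite (big_cat_nat (leq0n N) (ltnW NJ))/=.
by move: hN; lra.
Qed.

Lemma bounded_sumsB u v : bounded_sums u -> bounded_sums v ->
  bounded_sums (fun j => u j - v j).
Proof.
move=> [A uA] [B vB]; exists (A + B) => J.
apply: (le_trans _ (lerD (uA J) (vB J))); rewrite -big_split/=.
by apply: ler_sum => j _; exact: ler_normB.
Qed.

Lemma has_cfB u v F G : has_cf u F -> has_cf v G ->
  has_cf (fun j => u j - v j) (fun t => F t - G t).
Proof.
move=> uF vG t eps eps0; have e2 : 0 < eps / 2 by lra.
have [J1 h1] := uF t _ e2; have [J2 h2] := vG t _ e2.
exists (maxn J1 J2) => J; rewrite geq_max => /andP[/h1 {}h1 /h2 {}h2].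
under eq_bigr do rewrite rmorphB/= mulrBr.
rewrite sumrB; set a := \sum_(0 <= i < J) _ in h1 *.
set b := \sum_(0 <= i < J) _ in h2 *.
have -> : a - b - (F t - G t) = (a - F t) - (b - G t) by ring.
by rewrite (le_trans (normcB_le _ _))//; lra.
Qed.

Lemma has_cfZ u F (a : K) : has_cf u F ->
  has_cf (fun j => u j * a) (fun t => F t * a%:C).
Proof.
move=> uF t eps eps0.
have e1 : 0 < eps / (`|a| + 1) by rewrite divr_gt0// ltr_wpDl.
have [J0 h] := uF t _ e1; exists J0 => J /h {}h.
under eq_bigr do rewrite rmorphM/= mulrA.
rewrite -mulr_suml -mulrBl Normc.normcM normc_real.
apply: (le_trans (ler_wpM2r (normr_ge0 a) h)).
by rewrite mulrAC ler_pdivrMr ?ltr_wpDl// ler_wpM2l ?(ltW eps0)// lerDl.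
Qed.

Lemma bounded_sumsZ u (a : K) : bounded_sums u -> bounded_sums (fun j => u j * a).
Proof.
move=> [A uA]; exists (A * `|a|) => J.
under eq_bigr do rewrite normrM.
by rewrite -mulr_suml ler_wpM2r.
Qed.

Section Shift.
Variables (u : nat -> K) (c : nat).

Definition shift_seq (k : nat) : K := if (c <= k)%N then u (k - c)%N else 0.

(** General in [f] and [V], to serve both the sums of absolute values and the complex Fourier
    sums. *)
Lemma sum_shift (V : nmodType) (f : nat -> K -> V) (J : nat) : (forall j, f j 0 = 0) ->
  (c <= J)%N ->
  \sum_(0 <= j < J) f j (shift_seq j) = \sum_(0 <= j < J - c) f (j + c)%N (u j).
Proof.
move=> f0 cJ; rewrite (big_cat_nat (leq0n c) cJ)/= big_nat big1 ?add0r.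
  rewrite -[X in \sum_(X <= i < _) _]add0n big_addn; apply: eq_bigr => j _.
  by rewrite /shift_seq leq_addl addnK.
by move=> j /andP[_ jc]; rewrite /shift_seq leqNgt jc.
Qed.

Lemma bounded_sums_shift : bounded_sums u -> bounded_sums shift_seq.
Proof.
move=> [A uA]; exists A => J.
have [cJ|Jc] := leqP c J.
  by rewrite (sum_shift (f := fun _ x => `|x|))// => j; rewrite normr0.
rewrite big_nat big1; last first.
  by move=> j /andP[_ jJ]; rewrite /shift_seq leqNgt (ltn_trans jJ Jc) normr0.
by have := uA 0%N; rewrite big_nil.
Qed.

Lemma has_cf_shift F : has_cf u F ->
  has_cf shift_seq (fun t => cis t ^+ c * F t).
Proof.
move=> uF t eps eps0; have [J0 h] := uF t _ eps0.
exists (J0 + c)%N => J J0J; have cJ : (c <= J)%N by rewrite (leq_trans _ J0J)// leq_addl.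
rewrite (sum_shift (f := fun j x => cis (t * j%:R) * x%:C))//; last first.
  by move=> j; rewrite mulr0.
rewrite (eq_bigr (fun j => cis t ^+ c * (cis (t * j%:R) * (u j)%:C))); last first.
  by move=> j _; rewrite !cisMn exprD [_ ^+ j * _]mulrC mulrA.
rewrite -mulr_sumr -mulrBr Normc.normcM normcX normc_cis expr1n mul1r.
by apply: h; rewrite leq_subRL// addnC.
Qed.

End Shift.

(* [v] is the convolution of [u] with [i |-> a * b ^ i]. *)
Section GeometricStep.
Variables (u v : nat -> K) (a b : K).
Hypotheses (b0 : 0 <= b) (b1 : b < 1) (v0 : v 0%N = u 0%N * a)
  (vS : forall i, v i.+1 = v i * b + u i.+1 * a).

Let b1' : 0 < 1 - b. Proof. by rewrite subr_gt0. Qed.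

Lemma bounded_sums_geometric : bounded_sums u -> bounded_sums v.
Proof.
move=> [A uA]; exists (`|a| * A / (1 - b)) => J.
have A0 : 0 <= A by have := uA 0%N; rewrite big_nil.
rewrite ler_pdivlMr//.
elim: J => [|J IH]; first by rewrite big_nil mul0r; nonneg.
rewrite big_nat_recl// v0.
apply: (@le_trans _ _ ((`|a| * A + b * \sum_(0 <= i < J) `|v i|) * (1 - b))).
  rewrite ler_wpM2r ?(ltW b1')//.
  apply: (@le_trans _ _ (`|a| * \sum_(0 <= j < J.+1) `|u j| + b * \sum_(0 <= i < J) `|v i|)).
    rewrite [in leRHS]big_nat_recl// mulrDr normrM mulrC -!addrA lerD2l !mulr_sumr.
    rewrite -big_split/=; apply: ler_sum => i _.
    by rewrite vS (le_trans (ler_normD _ _))// addrC !normrM (ger0_norm b0)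
      [X in X + _]mulrC [X in _ + X]mulrC.
  by rewrite lerD2r ler_wpM2l.
have := ler_wpM2l b0 IH; move: (b1'); move: (`|a| * A) => X.
by lra.
Qed.

(** The recurrence expresses the partial sum of [v] up to [J.+1] through the one up to [J]. Both
    differ by a single term, so the sum can be solved for; that term is small by summability, and
    [normc (1 - b z) >= 1 - b]. *)
Lemma has_cf_geometric F : bounded_sums u -> has_cf u F ->
  has_cf v (fun t => F t * (a%:C / (1 - b%:C * cis t))).
Proof.
move=> bu uF t eps eps0.
pose z := cis t.
have bz : 1 - b <= normc (1 - b%:C * z).
  have := normcB_le (1 - b%:C * z) (- (b%:C * z)).
  rewrite opprK subrK Normc.normc1 normcN_eq Normc.normcM normc_real ger0_norm//.
  by rewrite normc_cis mulr1; lra.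
have bz0 : 1 - b%:C * z != 0 by rewrite -normc_gt0 (lt_le_trans b1').
pose e := eps * (1 - b) / (`|a| + 1).
have a1 : 0 < `|a| + 1 by rewrite ltr_wpDl.
have e0 : 0 < e by rewrite divr_gt0 ?mulr_gt0.
have [N hN] := bounded_sums_tail (bounded_sums_geometric bu) e0.
have [J0 h] := uF t _ e0.
exists (maxn N J0) => J; rewrite geq_max => /andP[NJ J0J].
pose S J := \sum_(0 <= j < J) cis (t * j%:R) * (u j)%:C.
pose S' J := \sum_(0 <= j < J) cis (t * j%:R) * (v j)%:C.
have S'S : S' J.+1 = a%:C * S J.+1 + b%:C * z * S' J.
  rewrite /S' /S !big_nat_recl//= v0 !mulr0 rmorphM mulrDr -!addrA; congr (_ + _).
    by ring.
  rewrite !mulr_sumr -big_split/=; apply: eq_bigr => j _.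
  by rewrite vS rmorphD !rmorphM/= !cisMn (exprS (cis t) j) -/z; ring.
have S'1 : S' J.+1 = S' J + cis (t * J%:R) * (v J)%:C by rewrite /S' big_nat_recr.
have -> : S' J - F t * (a%:C / (1 - b%:C * z)) =
    (a%:C * (S J.+1 - F t) - cis (t * J%:R) * (v J)%:C) / (1 - b%:C * z).
  apply: (mulIf bz0); rewrite [RHS]divfK// mulrBl mulrA divfK//.
  have -> : cis (t * J%:R) * (v J)%:C = S' J.+1 - S' J by rewrite S'1 addrC addKr.
  by rewrite S'S; ring.
rewrite Normc.normcM Normc.normcV ler_pdivrMr ?(lt_le_trans b1')//.
apply: (@le_trans _ _ (eps * (1 - b))); last by rewrite ler_wpM2l ?(ltW eps0).
rewrite (le_trans (normcB_le _ _))// 2!Normc.normcM !normc_real normc_cis mul1r.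
have vJ : `|v J| <= e.
  apply: le_trans (hN J.+1); rewrite (big_cat_nat NJ (leqnSn J))/= big_nat1.
  by rewrite lerDr sumr_ge0.
have SJ := h J.+1 (leqW J0J).
apply: (@le_trans _ _ (`|a| * e + e)); first by rewrite lerD// ler_wpM2l.
by rewrite -[X in _ + X]mul1r -mulrDl mulrC /e divfK// gt_eqF.
Qed.

End GeometricStep.

Section HitGeneratingFunction.
Variables (n m : nat).
Hypotheses (m1 : (0 < m)%N) (mn : (m < n)%N).

Let n0 : (0 < n)%N. Proof. exact: leq_ltn_trans mn. Qed.
Let nK : (n%:R : K) != 0. Proof. by rewrite pnatr_eq0 -lt0n. Qed.

Lemma hit_prob_cf j : (j < n)%N -> bounded_sums (hit_prob K n j) /\
  has_cf (hit_prob K n j) (fun t => \prod_(0 <= i < j)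
    (((n%:R - i%:R) / n%:R)%:C / (1 - (i.+1%:R / n%:R)%:C * cis t))).
Proof.
elim: j => [|j IH] jn.
  have zero : forall V : nmodType, forall (f : nat -> K -> V) J, (forall i, f i 0 = 0) ->
      (0 < J)%N -> \sum_(0 <= i < J) f i (hit_prob K n 0 i) = f 0%N 1.
    move=> V f [//|J] f0 _; rewrite big_nat_recl// hit_prob00 big1 ?addr0// => i _.
    by rewrite hit_prob0S.
  split.
    exists 1 => -[|J]; first by rewrite big_nil.
    rewrite (zero _ (fun _ x => `|x|))//; first by rewrite normr1.
    by move=> i; rewrite normr0.
  move=> t eps eps0; exists 1%N => J J1.
  rewrite (zero _ (fun i x => cis (t * i%:R) * x%:C))//; last by move=> i; rewrite mulr0.
  by rewrite big_nil cisMn expr0 mul1r subrr Normc.normc0 ltW.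
have [bj cj] := IH (ltnW jn).
have b1 : (j.+1%:R / n%:R : K) < 1.
  by rewrite ltr_pdivrMr ?ltr0n// mul1r ltr_nat.
have b0 : (0 : K) <= j.+1%:R / n%:R by nonneg.
have jn' : (j <= n)%N by rewrite ltnW// ltnW.
have v0 := hit_probS0 K n0 jn'.
have vS i := hit_probSS K n0 i jn'.
split; first exact: (bounded_sums_geometric b0 b1 v0 vS bj).
have := has_cf_geometric b0 b1 v0 vS bj cj.
congr has_cf; apply/funext => t; by rewrite big_nat_recr.
Qed.

Definition odds : seq K := [seq (n%:R - k%:R) / k%:R | k <- index_iota m.+1 n.+1].

Definition waiting_pmf (c : nat) : nat -> K :=
  shift_seq (fun i => hit_prob K n (n - m).-1 i * (m.+1%:R / n%:R)) c.

Lemma waiting_pmf_bounded c : bounded_sums (waiting_pmf c).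
Proof.
apply: bounded_sums_shift; apply: bounded_sumsZ.
by have [] := @hit_prob_cf (n - m).-1 ltac:(lia).
Qed.

Lemma waiting_pmf_cf c : has_cf (waiting_pmf c) (fun t => waiting_cf odds c (cis t - 1)).
Proof.
have [_ h] := @hit_prob_cf (n - m).-1 ltac:(lia).
have := has_cf_shift c (has_cfZ (m.+1%:R / n%:R) h).
suff -> : (fun t => waiting_cf odds c (cis t - 1)) = (fun t => cis t ^+ c *
    (\prod_(0 <= i < (n - m).-1) (((n%:R - i%:R) / n%:R)%:C /
       (1 - (i.+1%:R / n%:R)%:C * cis t)) * (m.+1%:R / n%:R)%:C)) by [].
apply/funext => t; rewrite /waiting_cf [1 + _]addrC subrK; congr (_ * _).
rewrite /odds big_map; set z := cis t.
have denom (i : nat) : (i < n)%N -> 1 - (i%:R / n%:R)%:C * z != 0.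
  move=> iN; rewrite -normc_gt0.
  have := normcB_le (1 - (i%:R / n%:R)%:C * z) (- ((i%:R / n%:R)%:C * z)).
  rewrite opprK subrK Normc.normc1 normcN_eq Normc.normcM normc_real normc_cis mulr1.
  have : (i%:R / n%:R : K) < 1 by rewrite ltr_pdivrMr ?ltr0n// mul1r ltr_nat.
  by rewrite ger0_norm; [lra|nonneg].
clearbody z.
(* With [k = n - i], the factor [1 - q_k (z - 1)] is [(1 - (i / n) z) / (1 - i / n)]. *)
transitivity (\prod_(0 <= i < n - m) (((n%:R - i%:R) / n%:R)%:C *
    (1 - (i%:R / n%:R)%:C * z)^-1)).
  rewrite big_nat_rev/= -[X in \prod_(X <= i < _) _]add0n big_addn.
  have -> : (n.+1 - m.+1 = n - m)%N by lia.
  rewrite big_nat [RHS]big_nat; apply: eq_bigr => i /andP[_ inm].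
  have -> : (m.+1 + n.+1 - (i + m.+1).+1 = n - i)%N by lia.
  have iN : (i < n)%N by lia.
  rewrite (natrB K (ltnW iN)).
  have ni : (n%:R - i%:R : K) != 0 by rewrite -natrB ?(ltnW iN)// pnatr_eq0; lia.
  have -> : 1 - ((n%:R - (n%:R - i%:R)) / (n%:R - i%:R))%:C * (z - 1) =
      (n%:R / (n%:R - i%:R))%:C * (1 - (i%:R / n%:R)%:C * z).
    have -> : (n%:R / (n%:R - i%:R) : K) = 1 + i%:R / (n%:R - i%:R) by field.
    have -> : (n%:R - (n%:R - i%:R)) / (n%:R - i%:R) = i%:R / (n%:R - i%:R) :> K by field.
    have AB : (1 + i%:R / (n%:R - i%:R)) * (i%:R / n%:R) = i%:R / (n%:R - i%:R) :> K.
      by field; rewrite nK ni.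
    move: (i%:R / (n%:R - i%:R) : K) (i%:R / n%:R : K) AB => A b AB.
    transitivity ((1 + A)%:C - ((1 + A) * b)%:C * z); last by rewrite rmorphM/=; ring.
    by rewrite AB rmorphD rmorph1/=; ring.
  by rewrite invfM -fmorphV invf_div.
(* In [hit_prob_cf] the denominators run one index ahead of the numerators: the denominator at
   [i = 0] is 1, and the missing last numerator is [m.+1 / n]. *)
rewrite !big_split/=.
have -> : (n - m = (n - m).-1.+1)%N by lia.
rewrite [X in X * _]big_nat_recr//= [X in _ * X]big_nat_recl//=.
rewrite !mul0r subr0 invr1 mul1r -!mulrA; congr (_ * _); rewrite mulrC; congr (_ * _).
by congr (_%:C); congr (_ / _); rewrite -natrB; [congr (_%:R); lia|lia].
Qed.

End HitGeneratingFunction.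
End GeneratingFunctions.

(** * Absolute summability and transform of the signed measure *)

Section SignedMeasure.
Variables (K : realType) (nu : {charge set nat -> \bar K}).

Lemma charge_fin (A : set nat) : nu A \is a fin_num.
Proof. exact: fin_num_measure. Qed.

(** Countable additivity on the points selected by [Q], padded with empty sets, gives convergence to
    a finite limit, and monotone partial sums stay below it. Taking [e = 1] and [e = -1] covers both
    signs without a Hahn decomposition. *)
Lemma bounded_sums_part (Q : pred nat) (e : K) :
  (forall j, Q j -> 0 <= e * fine (nu [set j])) ->
  exists A : K, forall J, \sum_(0 <= j < J) (if Q j then e * fine (nu [set j]) else 0) <= A.
Proof.
move=> Q0.
pose F j : set nat := if Q j then [set j] else set0.
have mF j : measurable (F j) by [].
have tF : trivIset setT F.
  apply/trivIsetP => i j _ _ ij; rewrite /F; case: (Q i); case: (Q j);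
    rewrite ?setI0 ?set0I//.
  by apply/seteqP; split=> // x /= [-> h]; rewrite h eqxx in ij.
have := @charge_semi_sigma_additive _ _ _ nu F mF tF ltac:(by []).
rewrite -(fineK (charge_fin _)) => /fine_cvg.
have -> : fine \o (fun n0 => (\sum_(0 <= i < n0) nu (F i))%E) =
    (fun n0 => \sum_(0 <= i < n0) fine (nu (F i))).
  apply/funext => J /=.
  rewrite (eq_bigr (fun i => (fine (nu (F i)))%:E)); last first.
    by move=> i _; rewrite fineK// charge_fin.
  by rewrite sumEFin.
set l := fine _ => cv.
have cv' : (fun J => e * \sum_(0 <= i < J) fine (nu (F i))) @ \oo --> e * l.
  by apply: cvgM => //; exact: cvg_cst.
have eE J : e * \sum_(0 <= i < J) fine (nu (F i)) =
    \sum_(0 <= j < J) (if Q j then e * fine (nu [set j]) else 0).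
  rewrite mulr_sumr; apply: eq_bigr => i _; rewrite /F.
  by case: (Q i); rewrite // charge0 mulr0.
have nd : nondecreasing_seq (fun J => e * \sum_(0 <= i < J) fine (nu (F i))).
  move=> a b ab; rewrite !eE (big_cat_nat (leq0n a) ab)/= lerDl sumr_ge0// => i _.
  by case: ifPn => // /Q0.
exists (e * l) => J; rewrite -eE -(cvg_lim _ cv')//.
by apply: (nondecreasing_cvgn_le nd); apply/cvgP; exact: cv'.
Qed.

Lemma charge_bounded_sums : bounded_sums (fun j => fine (nu [set j])).
Proof.
have [A hA] := @bounded_sums_part (fun j => 0 <= fine (nu [set j])) 1
  ltac:(by move=> j; rewrite mul1r).
have [B hB] := @bounded_sums_part (fun j => fine (nu [set j]) < 0) (-1)
  ltac:(by move=> j /ltW; rewrite mulN1r oppr_ge0).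
exists (A + B) => J; apply: le_trans (lerD (hA J) (hB J)).
rewrite -big_split/=; apply: ler_sum => j _.
by case: (leP 0 (fine (nu [set j]))) => h;
  rewrite ?mul1r ?addr0 ?mulN1r ?add0r ?(ger0_norm h) ?(ltr0_norm h).
Qed.

Lemma poisson_charlier_cf (n m r : nat) :
  poisson_charlier n m r nu ->
  has_cf (fun j => fine (nu [set j])) (fun t =>
    cexp ((coupon_sigma2 K n m)%:C * (cis t - 1)) *
    (map_poly (real_complex K) (coupon_H K n m r)).[cis t - 1]).
Proof.
move=> nuP t eps eps0.
have e0 : 0 < eps%:C :> K[i] by rewrite ltcR.
have [J0 _ h] := (@cvgrPdist_le K[i] K[i]^o nat \oo eventually_filter _ _).1 (nuP t) _ e0.
exists J0 => J /h /=.
by rewrite distrC normrC lecR.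
Qed.

End SignedMeasure.

Section Specialization.
Variables (K : realType) (n m r : nat).
Local Notation qs := (odds K n m).

Lemma coupon_aE j : coupon_a K n m j = power_sum qs j.
Proof. by rewrite /power_sum /odds big_map. Qed.

Lemma coupon_sigma2E :
  coupon_sigma2 K n m = power_sum qs 1 + power_sum qs 2.
Proof.
rewrite /power_sum /odds !big_map -big_split/= /coupon_sigma2 mulr_sumr.
apply: eq_big_nat => k /andP[mk _].
have k0 : (k%:R : K) != 0 by rewrite pnatr_eq0 -lt0n (leq_trans _ mk).
by field.
Qed.

Lemma charlier_cfE (c : nat) (w : K[i]) : coupon_c K n m = c ->
  cexp ((coupon_sigma2 K n m)%:C * w) *
    (map_poly (real_complex K) (coupon_H K n m r)).[w] = charlier_cf qs c r w.
Proof.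
move=> cE; rewrite coupon_sigma2E /charlier_cf; congr (_ * _).
rewrite /H_eval /coupon_H rmorph_sum horner_sum; apply: eq_bigr => l _.
rewrite /= map_polyZ hornerZ rmorphXn horner_exp/= fmorphV rmorph_nat; congr (_ * _ ^+ _).
rewrite /coupon_h /h_eval !coupon_aE cE -pmulrn !rmorphD/= !hornerD.
congr (_ + _ + _).
- by rewrite map_polyZ hornerZ map_polyX hornerX -rmorphD -rmorphN.
- by rewrite map_polyZ hornerZ map_polyXn hornerXn.
- rewrite rmorph_sum horner_sum; apply: eq_bigr => i _.
  by rewrite /= map_polyZ hornerZ map_polyXn hornerXn coupon_aE.
Qed.

End Specialization.

(** * Local limit bound and the two regimes *)

Section LocalLimit.
Variable K : realType.

Lemma odds_ge0 n m (q : K) : q \in odds K n m -> 0 <= q.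
Proof.
move=> /mapP[k]; rewrite mem_index_iota => /andP[_ kn] ->.
by rewrite divr_ge0// subr_ge0 ler_nat.
Qed.

Lemma odds_le n m (q : K) : q \in odds K n m -> q <= n%:R / m.+1%:R - 1.
Proof.
move=> /mapP[k]; rewrite mem_index_iota => /andP[mk kn] ->.
have k0 : (0 < k%:R :> K) by rewrite ltr0n (leq_trans _ mk).
rewrite mulrBl divff ?gt_eqF// lerD2r ler_wpM2l// lef_pV2 ?posrE ?ltr0n//;
  [by rewrite ler_nat|exact: leq_trans mk].
Qed.

Lemma local_limit_le (r : nat) : (3 <= r)%N -> exists2 C : K, 0 < C &
  forall n m : nat, (0 < m)%N -> (m < n)%N ->
  forall (d : measure_display) (T : measurableType d) (P : probability T K)
    (D : nat -> T -> 'I_n), coupon_draws P D ->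
  forall nu : {charge set nat -> \bar K}, poisson_charlier n m r nu ->
  forall B rho sigma : K, 0 < sigma -> sigma ^+ 2 = coupon_sigma2 K n m ->
    1 <= rho -> 1 <= B -> B <= rho ^+ 2 ->
    coupon_a K n m 2 * rho ^+ 2 <= B * sigma ^+ 2 ->
    n%:R / m.+1%:R * rho <= 4 * sigma ->
  (ereal_sup (range (fun k : int => `|coupon_mu P D m k - int_mass nu k|))
    <= (C * (B / rho ^+ r.+2))%:E)%E.
Proof.
move=> r3; have [C C0 hC] := sub_cf_le K r3.
(* [rho <= 4 * sigma] gives [alpha / sigma <= 4 * beta], hence
   [4 * (alpha / sigma) + beta <= 17 * beta]. *)
exists (17 * C); first by rewrite mulr_gt0.
move=> n m m0 mn d T P D DP nu nuP B rho sigma s0 sE r1 B1 Br a2 Qr.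
have [c cE] : exists c : nat, coupon_c K n m = c.
  have : 0 <= coupon_c K n m.
    by rewrite /coupon_c floor_ge0 coupon_aE power_sum_ge0// => q /odds_ge0.
  by case: (coupon_c K n m) => // c _; exists c.
have /andP[c_le c_gt] := floor_itv (coupon_a K n m 2).
rewrite -/(coupon_c K n m) cE coupon_aE -pmulrn in c_le.
rewrite -/(coupon_c K n m) cE coupon_aE -PoszD -pmulrn natrD in c_gt.
have Q0 : 0 <= n%:R / m.+1%:R - 1 :> K.
  by rewrite subr_ge0 ler_pdivlMr ?ltr0n// mul1r ler_nat.
have rho0 : 0 < rho by lra.
have rs : rho <= 4 * sigma.
  by apply: le_trans Qr; rewrite ler_peMl ?(ltW rho0)// -subr_ge0.
pose alpha := C * (B / rho ^+ r.+1).
pose beta := C * (B / rho ^+ r.+2).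
have B0 : 0 <= B by lra.
have a0 : 0 <= alpha by rewrite /alpha; nonneg.
pose u j : K := waiting_pmf K n m c j - fine (nu [set j]).
have ub : bounded_sums u.
  by apply: bounded_sumsB; [exact: waiting_pmf_bounded|exact: charge_bounded_sums].
have ucf : has_cf u (fun t => waiting_cf (odds K n m) c (cis t - 1) -
    charlier_cf (odds K n m) c r (cis t - 1)).
  apply: has_cfB; first exact: waiting_pmf_cf.
  have := poisson_charlier_cf nuP; congr has_cf; apply/funext => t.
  exact: charlier_cfE.
have sc : cf_scaling (odds K n m) c (n%:R / m.+1%:R - 1) B rho sigma.
  split=> //; [exact: odds_ge0|exact: odds_le|by rewrite lerBlDl ltW
    |by rewrite -coupon_sigma2E|by rewrite -coupon_aE|by rewrite addrCA subrr addr0].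
have bound t : normc (waiting_cf (odds K n m) c (cis t - 1) -
    charlier_cf (odds K n m) c r (cis t - 1)) <=
    alpha / (1 + (sigma * normc (cis t - 1)) ^+ 2) + beta.
  have cis1 : normc (1 + (cis t - 1)) = 1 by rewrite addrCA subrr addr0 normc_cis.
  by apply: (le_trans (hC _ _ _ _ _ _ _ sc cis1)); rewrite mulrDr mulrA.
have := fourier_sup_le s0 a0 (bounded_sums_tail ub) ucf bound.
have as_le : 4 * (alpha / sigma) + beta <= 17 * C * (B / rho ^+ r.+2).
  have : alpha / sigma <= 4 * beta.
    rewrite ler_pdivrMr// /alpha /beta (exprS rho r.+1).
    have X0 : 0 <= C * (B / rho ^+ r.+1) / rho by nonneg.
    have := ler_wpM2l X0 rs; rewrite divfK ?gt_eqF//.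
    rewrite invfM; move: (rho ^+ r.+1)^-1 rho^-1 => x y; lra.
  by rewrite /beta; lra.
move=> uk; apply: ge_ereal_sup => _ [k _ <-].
rewrite (coupon_muE DP m0 mn) cE.
case: k => [k|k] /=; last first.
  (* At negative points both masses vanish, because [c >= 0]. *)
  have -> : Negz k - c%:Z = Negz (k + c) by rewrite !NegzE -opprD -PoszD addSn.
  have h0 : 0 <= 17 * C * (B / rho ^+ r.+2) by apply: mulr_ge0; nonneg.
  by rewrite subrr normr0 lee_fin.
rewrite -(fineK (charge_fin nu [set k])) -EFinB lee_fin.
have -> : (match k%:Z - c%:Z with
   | Posz i => hit_prob K n (n - m).-1 i * (m.+1%:R / n%:R) | Negz _ => 0 end)
    = waiting_pmf K n m c k.
  rewrite /waiting_pmf /shift_seq; have [ck|kc] := leqP c k.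
    by rewrite subzn.
  suff -> : k%:Z - c%:Z = Negz (c - k).-1 by [].
  by rewrite NegzE prednK ?subn_gt0// -subzn ?(ltnW kc)// opprB.
by apply: (le_trans (uk k)).
Qed.

End LocalLimit.

(** * Lower bounds for the variance and an upper bound for [coupon_a 2] *)

Section VarianceBounds.
Variables (K : realType) (n m : nat).
Hypotheses (m0 : (0 < m)%N) (mn : (m < n)%N).

Lemma sum_complement (p : nat) : (m + p <= n)%N ->
  2 * \sum_(m.+1 <= k < (m + p).+1) (n%:R - k%:R : K) =
  p%:R * (2 * n%:R - 2 * m%:R - p%:R - 1).
Proof.
elim: p => [|p IH] pn; first by rewrite addn0 big_geq// mulr0 mul0r.
rewrite addnS big_nat_recr/=; last by rewrite ltnS leq_addr.
rewrite mulrDr IH; last by rewrite (leq_trans _ pn)// leq_add2l.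
have -> : (m + p).+1%:R = m%:R + p%:R + 1 :> K by rewrite -natr1 natrD.
by rewrite -[p.+1%:R]natr1; ring.
Qed.

(** Keep the first [p] terms and replace their denominators by [M ^+ 2]; what is left is an
    arithmetic sum. *)
Lemma le_sum_complement (p : nat) (M : K) : (m + p <= n)%N -> 0 < M ->
  (forall k, (k <= m + p)%N -> k%:R <= M) ->
  n%:R * (p%:R * (2 * n%:R - 2 * m%:R - p%:R - 1)) / (2 * M ^+ 2) <= coupon_sigma2 K n m.
Proof.
move=> pn M0 kM; rewrite /coupon_sigma2 -mulrA ler_wpM2l// -sum_complement//.
rewrite [leRHS](big_cat_nat (n := (m + p).+1))/=; last 2 first.
- by rewrite ltnS leq_addr.
- by rewrite ltnS.
rewrite -[leLHS]addr0 lerD//; last first.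
  rewrite big_nat; apply: sumr_ge0 => k /andP[_ kn].
  by rewrite divr_ge0// subr_ge0 ler_nat.
rewrite invfM mulrACA divff ?mul1r ?pnatr_eq0// mulr_suml.
rewrite !big_nat; apply: ler_sum => k /andP[mk kp].
have k0 : (0 < k%:R :> K) by rewrite ltr0n (leq_trans _ mk).
have kn : (k <= n)%N by rewrite -ltnS (leq_trans kp).
rewrite ler_wpM2l ?subr_ge0 ?ler_nat//.
by rewrite lef_pV2 ?posrE ?exprn_gt0// lerXn2r ?nnegrE ?kM// ltW.
Qed.

Lemma sigma2_ge_small : (2 * m.+1 <= n)%N ->
  n%:R ^+ 2 / (16 * m%:R) <= coupon_sigma2 K n m.
Proof.
move=> mn2; have m0' : 0 < m%:R :> K by rewrite ltr0n.
(* The block [m < k <= 2 m] alone gives the right order; there [2 n - 3 m - 1 >= n / 2]. *)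
have h := @le_sum_complement m (2 * m%:R) _ _ _.
apply: le_trans (h _ _ _); [|lia|by rewrite mulr_gt0|]; last first.
  by move=> k; rewrite -natrM ler_nat; lia.
have n2 : 2 * (m%:R + 1) <= n%:R :> K.
  by rewrite natr1 -natrM ler_nat.
have -> : n%:R ^+ 2 / (16 * m%:R) =
    n%:R * (m%:R * (n%:R / 2)) / (2 * (2 * m%:R) ^+ 2) :> K.
  by field; rewrite gt_eqF.
have d0 : 0 <= (2 * (2 * m%:R) ^+ 2)^-1 :> K by nonneg.
by rewrite ler_wpM2r// ler_wpM2l// ler_wpM2l//; lra.
Qed.

Lemma sigma2_ge_large : (2 <= n - m)%N ->
  (n%:R - m%:R) ^+ 2 / (4 * n%:R) <= coupon_sigma2 K n m.
Proof.
move=> nm2; have n0' : 0 < n%:R :> K by rewrite ltr0n; lia.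
(* All terms are kept; [n - m >= 2] allows [N * (N - 1) >= N ^+ 2 / 2]. *)
have h := @le_sum_complement (n - m) n%:R _ _ _.
apply: le_trans (h _ _ _); [|lia|by []|]; last by move=> k; rewrite ler_nat; lia.
have N2 : 2 <= n%:R - m%:R :> K by rewrite -natrB ?(ltnW mn)// ler_nat.
rewrite natrB ?(ltnW mn)//; set N := _ - _ in N2 *.
have -> : 2 * n%:R - 2 * m%:R - N - 1 = N - 1 by rewrite /N; ring.
have -> : n%:R * (N * (N - 1)) / (2 * n%:R ^+ 2) = (2 * (N * (N - 1))) / (4 * n%:R).
  by field; rewrite gt_eqF.
have d0 : 0 <= (4 * n%:R)^-1 :> K by nonneg.
by rewrite ler_wpM2r// expr2; nra.
Qed.

Lemma coupon_a_le_sigma2 : coupon_a K n m 2 <= coupon_sigma2 K n m.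
Proof.
rewrite coupon_sigma2E coupon_aE lerDr power_sum_ge0// => q; exact: odds_ge0.
Qed.

Lemma coupon_a2_le : (n <= 2 * m)%N ->
  coupon_a K n m 2 <= 4 * (n%:R - m%:R) ^+ 3 / n%:R ^+ 2.
Proof.
move=> nm2; have n0' : 0 < n%:R :> K by rewrite ltr0n; lia.
rewrite /coupon_a.
apply: (@le_trans _ _ (\sum_(m.+1 <= k < n.+1) 4 * (n%:R - m%:R) ^+ 2 / n%:R ^+ 2)).
  rewrite !big_nat; apply: ler_sum => k /andP[mk kn].
  have -> : 4 * (n%:R - m%:R) ^+ 2 / n%:R ^+ 2 = (2 * (n%:R - m%:R) / n%:R) ^+ 2 :> K.
    by field; rewrite gt_eqF.
  have k0 : (0 < k%:R :> K) by rewrite ltr0n; lia.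
  have kn' : k%:R <= n%:R :> K by rewrite ler_nat.
  have mk' : m%:R <= k%:R :> K by rewrite ler_nat; lia.
  have nm2' : n%:R <= 2 * m%:R :> K by rewrite -natrM ler_nat.
  rewrite lerXn2r ?nnegrE ?divr_ge0 ?mulr_ge0 ?subr_ge0 ?(le_trans mk')//.
  rewrite ler_pdivrMr// mulrAC ler_pdivlMr//.
  have : (n%:R - k%:R) * n%:R <= (n%:R - m%:R) * (2 * k%:R) :> K.
    by apply: ler_pM => //; lra.
  by lra.
rewrite sumr_const_nat subSS -[leLHS]mulr_natl natrB ?(ltnW mn)//.
by rewrite le_eqVlt; apply/orP; left; apply/eqP; ring.
Qed.

Lemma coupon_a2_gap : 1 < coupon_a K n m 2 -> (2 <= n - m)%N.
Proof.
move=> a2; rewrite leqNgt; apply/negP => nm.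
have nE : n = m.+1 by lia.
move: a2; rewrite /coupon_a nE big_nat1 subrr mul0r expr0n/=.
by rewrite ltr10.
Qed.

End VarianceBounds.

Theorem theorem7p0p1 (K : realType) (r : nat) (hr : (3 <= r)%N) :
  exists (m_r n_r : nat) (C_r : K), 0 < C_r /\
  forall (n m : nat), (1 <= m)%N -> (m <= n - 1)%N ->
    (m_r <= m)%N -> (n_r <= n)%N -> 1 < coupon_a K n m 2 ->
  forall (d : measure_display) (T : measurableType d) (P : probability T K)
    (D : nat -> T -> 'I_n), coupon_draws P D ->
  forall nu : {charge set nat -> \bar K}, poisson_charlier n m r nu ->
    (m%:R <= n%:R / 2 - 1 :> K ->
      (ereal_sup (range (fun k : int => `|coupon_mu P D m k - int_mass nu k|))
        <= (C_r * (1 / Num.sqrt m%:R) ^+ r)%:E)%E)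
    /\
    (n%:R / 2 <= m%:R :> K ->
      (ereal_sup (range (fun k : int => `|coupon_mu P D m k - int_mass nu k|))
        <= (C_r * (Num.sqrt n%:R ^+ (r - 2) / (n%:R - m%:R) ^+ (r - 1)))%:E)%E).
Proof.
have [C C0 hC] := local_limit_le K hr.
(* The 4 comes from [coupon_a2_le], the power of 2 from [sigma >= (n - m) / (2 sqrt n)]; both enter
   in the second regime. *)
pose C' := C * (4 * 2 ^+ r.+2).
have CC' : C <= C'.
  rewrite /C' ler_peMr ?(ltW C0)//.
  have : 1 <= 2 ^+ r.+2 :> K by rewrite exprn_ege1// ler1n.
  by lra.
(* The estimates are uniform over all admissible [n] and [m], hence the thresholds 0. *)
exists 0%N, 0%N, C'; split; first by rewrite (lt_le_trans C0).
move=> n m m0 mn1 _ _ a2 d T P D DP nu nuP.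
have mn : (m < n)%N by lia.
have nm2 := coupon_a2_gap m0 mn a2.
have s2_gt1 : 1 < coupon_sigma2 K n m.
  by apply: lt_le_trans (coupon_a_le_sigma2 _ _ _); exact: a2.
pose sigma := Num.sqrt (coupon_sigma2 K n m).
have sE : sigma ^+ 2 = coupon_sigma2 K n m by rewrite sqr_sqrtr//; lra.
have s0 : 0 < sigma by rewrite sqrtr_gt0; lra.
have m0' : 0 < m%:R :> K by rewrite ltr0n.
have n0' : 0 < n%:R :> K by rewrite ltr0n (leq_trans _ mn).
have hCn := hC n m m0 mn d T P D DP nu nuP.
split=> hm.
  pose rho : K := Num.sqrt m%:R.
  have rE : rho ^+ 2 = m%:R by rewrite sqr_sqrtr.
  have r0 : 0 < rho by rewrite sqrtr_gt0.
  have r1 : 1 <= rho by rewrite -sqrtr1 ler_wsqrtr// ler1n.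
  have mn2 : (2 * m.+1 <= n)%N.
    have : (2 * m.+1)%:R <= n%:R :> K by rewrite natrM -natr1; lra.
    by rewrite ler_nat.
  have sge := sigma2_ge_small K m0 mn mn2.
  apply: (le_trans (hCn m%:R rho sigma s0 sE r1 _ _ _ _)).
  - by rewrite ler1n.
  - by rewrite rE.
  - by rewrite rE sE mulrC ler_wpM2l// coupon_a_le_sigma2.
  (* Squared, the claim follows from [n^2 / m <= 16 sigma^2], which is [sigma2_ge_small]. *)
  - have m1' : 0 < m.+1%:R :> K by rewrite ltr0n.
    have X0 : 0 <= n%:R / m.+1%:R * rho by nonneg.
    rewrite -(@ler_pXn2r _ 2) ?nnegrE ?mulr_ge0 ?(ltW s0) ?(ltW r0)//.
    rewrite !exprMn exprVn rE sE.
    have h : n%:R ^+ 2 / m%:R <= 4 ^+ 2 * coupon_sigma2 K n m.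
      have -> : n%:R ^+ 2 / m%:R = 4 ^+ 2 * (n%:R ^+ 2 / (16 * m%:R)) :> K.
        by field; rewrite gt_eqF.
      by rewrite ler_wpM2l.
    apply: le_trans h; rewrite -mulrA ler_wpM2l ?exprn_ge0//.
    rewrite [leLHS]mulrC ler_pdivrMr ?exprn_gt0// [leRHS]mulrC ler_pdivlMr// -expr2.
    by rewrite lerXn2r ?nnegrE// ler_nat.
  rewrite lee_fin; apply: (@le_trans _ _ (C' * (m%:R / rho ^+ r.+2))).
    by rewrite ler_wpM2r//; nonneg.
  rewrite le_eqVlt; apply/orP; left; apply/eqP; congr (_ * _).
  rewrite -/rho expr_div_n expr1n -addn2 exprD rE invfM mulrCA divff ?gt_eqF//.
  by rewrite mulr1 mul1r.
have nm : (n <= 2 * m)%N.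
  have : n%:R <= (2 * m)%:R :> K by rewrite natrM; lra.
  by rewrite ler_nat.
have N0 : 0 < n%:R - m%:R :> K by rewrite subr_gt0 ltr_nat.
set N : K := n%:R - m%:R in N0 *.
pose A := coupon_a K n m 2.
have sN := sigma2_ge_large K m0 mn nm2.
have aN := coupon_a2_le K m0 mn nm.
have sg1 : 1 <= sigma by rewrite -sqrtr1 ler_wsqrtr//; lra.
apply: (le_trans (hCn A sigma sigma s0 sE sg1 _ _ _ _)).
- exact: ltW.
- by rewrite sE coupon_a_le_sigma2.
- by rewrite -/A.
(* Here [n <= 2 m], so [n / m.+1] is below 4. *)
- rewrite ler_wpM2r ?(ltW s0)// ler_pdivrMr ?ltr0n// -natrM ler_nat; lia.
rewrite lee_fin /C' -mulrA ler_wpM2l ?(ltW C0)//.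
pose s : K := Num.sqrt n%:R.
have s_gt0 : 0 < s by rewrite sqrtr_gt0.
have ssE : s ^+ 2 = n%:R by rewrite sqr_sqrtr// ltW.
have sgN : N / (2 * s) <= sigma.
  rewrite -(@ler_pXn2r _ 2) ?nnegrE ?divr_ge0 ?mulr_ge0 ?(ltW s0) ?(ltW N0) ?(ltW s_gt0)//.
  rewrite expr_div_n exprMn ssE sE; apply: le_trans sN.
  by have -> : (2 : K) ^+ 2 = 4 by ring.
have N2s : 0 < N / (2 * s) by rewrite divr_gt0 ?mulr_gt0.
apply: (@le_trans _ _ (4 * N ^+ 3 / n%:R ^+ 2 / (N / (2 * s)) ^+ r.+2)).
  rewrite ler_pM//.
  - by rewrite ltW// (lt_trans ltr01).
  - by rewrite invr_ge0 exprn_ge0// ltW.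
  - by rewrite lef_pV2 ?posrE ?exprn_gt0// lerXn2r ?nnegrE ?(ltW s0) ?(ltW N2s).
(* Writing [r = q + 3] turns the truncated [r - 2] and [r - 1] into successors. With [s ^+ 2 = n],
   four of the [r + 2] powers of [s] cancel [n ^+ 2], and three of those of [N] cancel [N ^+ 3]. *)
rewrite -/s -ssE; case: r hr {hC nuP hCn C' CC'} => [|[|[|q]]]// _.
rewrite !subSS !subn0 expr_div_n.
have -> : N ^+ q.+1.+4 = N ^+ q.+2 * N ^+ 3 by rewrite -exprD addn3.
have -> : (2 * s) ^+ q.+1.+4 = 2 ^+ q.+1.+4 * (s ^+ q.+1 * s ^+ 4).
  by rewrite exprMn -exprD addn4.
have Nq : N ^+ q.+2 != 0 by rewrite expf_neq0 ?gt_eqF.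
have [sn Nn] : s != 0 /\ N != 0 by rewrite !gt_eqF.
rewrite le_eqVlt; apply/orP; left; apply/eqP.
move: (2 ^+ _ : K) (s ^+ q.+1) (N ^+ q.+2) Nq => a b e e0.
by rewrite invf_div; field; rewrite sn Nn e0.
Qed.
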